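(* Let $\Gamma_1,\Gamma_2$ be two quasi-isometric finitely generated amenable groups and let $E_1,E_2$ be finite nonempty sets. Let $I\subset\mathbb R$ be an interval, let $r\in I\mapsto p(r)$ be a continuous family of Markov transition kernels on $\Gamma_1\times E_1$ and $r\in I\mapsto q(r)$ be a continuous family of Markov transition kernels on $\Gamma_2\times E_2$. Assume that $p$ is $\Gamma_1$-invariant and $q$ is $\Gamma_2$-invariant, and that both are strongly reversible, uniformly irreducible and have continuous second moment (with respect to fixed finite symmetric generating sets $S_1$ of $\Gamma_1$ and $S_2$ of $\Gamma_2$). Then there exist a continuous function $r\in I\mapsto\epsilon(r)\in(0,1)$, an integer $n_0$ and a constant $C_0>0$ such that for every $r\in I$ and every $n$ with $\lfloor\epsilon(r)n\rfloor\ge n_0$, $$\frac{1}{|E_1|}\sum_{i\in E_1}p^{(2n)}_{r;i,i}(e,e)\le C_0\Big(\frac{1}{|E_2|}\sum_{i\in E_2}q^{(2\lfloor \epsilon(r)n\rfloor-2n_0)}_{r;i,i}(e,e)+(1-\epsilon(r))^{2n}\Big)$$ and $$\frac{1}{|E_2|}\sum_{i\in E_2}q^{(2n)}_{r;i,i}(e,e)\le C_0\Big( \frac{1}{|E_1|}\sum_{i\in E_1}p^{(2\lfloor \epsilon (r)n\rfloor-2n_0)}_{r;i,i}(e,e)+(1-\epsilon(r))^{2n}\Big).$$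
   Context: Let $\Gamma$ be a finitely generated group with finite symmetric generating set $S$, $E$ a finite set, $X=\Gamma\times E$. A Markov transition kernel on $X$ is a map $p:X\times X\to[0,\infty)$ with $\sum_{b\in X}p(a,b)=1$ for all $a\in X$; $p^{(n)}$ is its $n$th convolution power ($p^{(0)}$ the identity kernel, $p^{(n+1)}(a,b)=\sum_c p^{(n)}(a,c)p(c,b)$). A continuous family of Markov transition kernels on $X$ is a map $r\in I\mapsto p(r)$, each $p(r)$ a Markov transition kernel, such that $r\mapsto p_{r;i,j}(x,y):=p(r)((x,i),(y,j))$ is continuous for all $(x,i),(y,j)$; $p^{(n)}_{r;i,j}(x,y):=p^{(n)}(r)((x,i),(y,j))$. It is: - $\Gamma$-invariant if $p_{r;i,j}(gx,gy)=p_{r;i,j}(x,y)$ for all $r$, $g\in\Gamma$, $(x,i),(y,j)\in X$; - strongly reversible if there are functions $m(r):X\to\mathbb R_+$, written $m_{r;i}(x)=m(r)((x,i))$, continuous in $r$ for each $(x,i)$, with $m_{r;i}(x)p_{r;i,j}(x,y)=p_{r;j,i}(y,x)m_{r;j}(y)$ for all $r,(x,i),(y,j)$, and continuous positive functions $c,C$ on $I$ with $c(r)\le m_{r;i}(x)\le C(r)$ for all $r,(x,i)$; - uniformly irreducible (with respect to $S$) if there exist an integer $K$ and a continuous positive function $r\mapsto\varepsilon_*(r)$ such that $p^{(K)}_{r;i,j}(x,y)\ge\varepsilon_*(r)$ for all $r$, all $i,j\in E$ and all $x,y\in\Gamma$ with $x^{-1}y\in S$; - of continuous second moment (with respect to $S$;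 for a $\Gamma$-invariant family) if $\mathcal M_2(r)=\sum_{i,j\in E}\sum_{x\in\Gamma}d(e,x)^2p_{r;i,j}(e,x)$ is finite for every $r$ and continuous in $r$, where $d$ is the word distance of $S$. *)

(* Defs.v *)
From HB Require Import structures.
From mathcomp Require Import all_boot all_order all_algebra.
From mathcomp Require Import all_classical all_reals all_analysis.
Set Implicit Arguments.
Unset Strict Implicit.
Unset Printing Implicit Defensive.
Import Order.TTheory GRing.Theory Num.Theory.
Import numFieldNormedType.Exports.
Local Open Scope classical_set_scope.
Local Open Scope ring_scope.

Section Groups.
Variable G : groupType.
Implicit Types (S : set G) (x y : G).

Definition is_word S (n : nat) x : Prop :=
  exists w : seq G,
    [/\ size w = n, forall s, s \in w -> S s & (\prod_(s <- w) s)%g = x].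

(* Words in [S] suffice, inverses being available by symmetry. *)
Definition finite_symmetric_generating S : Prop :=
  [/\ finite_set S, forall s, S s -> S (s^-1)%g &
      forall x, exists n, is_word S n x].

Lemma is_word_exP S x :
  (exists n, is_word S n x) -> exists n, `[< is_word S n x >].
Proof. by case=> n Sn; exists n; apply/asboolP. Qed.

(* The length of a shortest word in [S] for x^-1 y; the value 0 when there is
   no such word does not occur for a generating set. *)
Definition word_dist S x y : nat :=
  match pselect (exists n, is_word S n (x^-1 * y)%g) with
  | left h => ex_minn (is_word_exP h)
  | right _ => 0%N
  end.

(* Existence of a left-invariant finitely additive probability measure on all
   subsets of the group. *)
Definition amenable (R : realType) : Prop :=
  exists mu : set G -> R,
    [/\ forall A, 0 <= mu A,
        mu setT = 1,
        forall A B, A `&` B = set0 -> mu (A `|` B) = mu A + mu B &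
        forall g A, mu [set (g * a)%g | a in A] = mu A].

End Groups.

Definition quasi_isometric (R : realType) (G1 G2 : groupType)
    (S1 : set G1) (S2 : set G2) : Prop :=
  exists (f : G1 -> G2) (A B : R),
    [/\ 1 <= A, 0 <= B,
        forall x y,
          A^-1 * (word_dist S1 x y)%:R - B <= (word_dist S2 (f x) (f y))%:R
            <= A * (word_dist S1 x y)%:R + B &
        forall z, exists x, (word_dist S2 (f x) z)%:R <= B].

Section Kernels.
Variables (R : realType) (X : choiceType).
Implicit Type p : X -> X -> R.

Definition markov_kernel p : Prop :=
  (forall a b, 0 <= p a b) /\
  (forall a, \esum_(b in [set: X]) (p a b)%:E = 1%E).

(* For a Markov kernel the sums are at most 1, so that [fine] is harmless. *)
Fixpoint kernel_pow p (n : nat) (a b : X) : R :=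
  if n is n'.+1
  then fine (\esum_(c in [set: X]) (kernel_pow p n' a c * p c b)%:E)
  else (a == b)%:R.

End Kernels.

(* Families indexed by [I] are functions on the whole of [R] of which only the
   values on [I] matter; continuity is relative to [I]. *)
Section Families.
Variables (R : realType) (I : set R) (G : groupType) (E : finType).
Implicit Types (S : set G) (p : R -> G * E -> G * E -> R).

Definition continuous_markov_family p : Prop :=
  (forall r, I r -> markov_kernel (p r)) /\
  (forall a b, {within I, continuous (fun r => p r a b)}).

Definition group_invariant p : Prop :=
  forall r, I r -> forall (g x y : G) (i j : E),
    p r ((g * x)%g, i) ((g * y)%g, j) = p r (x, i) (y, j).

Definition strongly_reversible p : Prop :=
  exists (m : R -> G * E -> R) (c C : R -> R),
    [/\ forall a, {within I, continuous (fun r => m r a)},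
        forall r, I r -> forall a b, m r a * p r a b = p r b a * m r b,
        {within I, continuous c} /\ {within I, continuous C},
        forall r, I r -> 0 < c r /\ 0 < C r &
        forall r, I r -> forall a, c r <= m r a <= C r].

Definition uniformly_irreducible S p : Prop :=
  exists (K : nat) (eps : R -> R),
    [/\ {within I, continuous eps}, forall r, I r -> 0 < eps r &
        forall r, I r -> forall (i j : E) (x y : G), S (x^-1 * y)%g ->
          eps r <= kernel_pow (p r) K (x, i) (y, j)].

Definition second_moment S p (r : R) : \bar R :=
  (\sum_(i : E) \sum_(j : E) \esum_(x in [set: G])
     ((word_dist S 1%g x)%:R ^+ 2 * p r (1%g, i) (x, j))%:E)%E.

Definition continuous_second_moment S p : Prop :=
  (forall r, I r -> second_moment S p r \is a fin_num) /\
  {within I, continuous (fun r => fine (second_moment S p r))}.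

End Families.

Definition mean_return (R : realType) (G : groupType) (E : finType)
    (p : G * E -> G * E -> R) (n : nat) : R :=
  #|E|%:R^-1 * \sum_(i : E) kernel_pow p n (1%g, i) (1%g, i).

(* Main.v *)
Require Import Defs.
From HB Require Import structures.
From mathcomp Require Import all_boot all_order all_algebra fingroup perm.
From mathcomp Require Import complex.
From mathcomp Require Import all_classical all_reals all_analysis.
From mathcomp Require Import ring lra zify.
Set Implicit Arguments.
Unset Strict Implicit.
Unset Printing Implicit Defensive.
Import Order.TTheory GRing.Theory Num.Theory.
Import numFieldNormedType.Exports.
Local Open Scope classical_set_scope.
Local Open Scope ring_scope.

(** Fix r. Truncating a reversible kernel to a finite set gives, after weighting,
a symmetric matrix with nonnegative entries, and all spectral arguments are
made on such matrices. The two groups are treated symmetrically, and there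
are two cases for the first group.

If it satisfies a linear isoperimetric inequality, Cheeger's inequality gives
a spectral gap and p^(2n)(e,e) <= (1 - eps)^(2n).

Otherwise it has Folner sets U, and the mean of p^(2n) is at most a constant
times Tr(P_U^(2n)) / |U|. The trace of the odd power 2n - 1 is nonnegative, so
the positive eigenvalues of P_U control Tr(P_U^(2n)). A coarse inverse
g : G2 -> G1 pulls a function u supported in U back to w = u o g supported in
V = g^-1(U), where |V| <= C |U|. The Dirichlet form of w is at most a constant
times that of u (second moment for q, irreducibility for p), and the norm of
u is controlled by that of w when the energy of u is small. By the min-max
principle an eigenvalue 1 - x of P_U with x small yields an eigenvalue of Q_V
at least 1 - D x, so Tr(P_U^(2n)) <= 2 (Tr(Q_V^(2N)) + |U| (1 - delta)^(2n-1))
for N <= eps n, while Tr(Q_V^(2N)) <= |V| sum_j q^(2N)((e,j),(e,j)).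

All constants are polynomial in a bound T(r) for the data of the two kernels,
so eps(r) = 1 / (k T(r)^8 + 1) is continuous, and the multiplicative constant
depends on the geometry alone. The case where both groups are finite is
separate, because irreducibility is vacuous for an empty generating set. *)

(** * Spectral theorem for real symmetric matrices *)

(** The estimate asks for a [C_0] independent of r, with all dependence on r inside epsilon, and
    this dictates the method. Bounds on weights, irreducibility and moments may only rescale the
    distance 1 - x of an eigenvalue to 1, that is, time. Two facts keep them out of the prefactor:
    the weights cancel in the diagonal entries of powers of the weighted matrix, and |V| <= C |U| is
    a count on the groups alone.

    Comparing eigenvalues says nothing about a single diagonal entry, so traces over a finite set
    are compared. To come back to the identity, at least half of the points of that set must see,
    inside the set, a whole window carrying half of the return probability; a Folner set provides
    this. The window, and with it the set, depends on n and on the kernel, but no constant does.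

    The threshold delta is forced by the transport: u o g samples a single layer of u, and only
    coarsely, so a strongly oscillating u can be lost. Eigenvalues away from 1 are therefore not
    compared but bounded by 1 - delta, which is the origin of the exponential term. *)

Section Spectral.
Variable R : rcfType.

Definition quad n (A : 'M[R]_n) (u : 'rV[R]_n) : R := (u *m A *m u^T) 0 0.

Definition sqnorm n (u : 'rV[R]_n) : R := \sum_i u 0 i ^+ 2.

Lemma mulmx_tr_sqnorm n (u : 'rV[R]_n) : u *m u^T = (sqnorm u)%:M.
Proof.
apply/rowP => i; rewrite ord1 !mxE /= mulr1n.
by apply: eq_bigr => k _; rewrite mxE expr2.
Qed.

Lemma sqnorm_ge0 n (u : 'rV[R]_n) : 0 <= sqnorm u.
Proof. by apply: sumr_ge0 => i _; exact: sqr_ge0. Qed.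

Lemma sqnorm_eq0 n (u : 'rV[R]_n) : (sqnorm u == 0) = (u == 0).
Proof.
apply/eqP/eqP => [|->]; last first.
  by apply: big1 => i _; rewrite mxE expr0n.
move=> /eqP; rewrite psumr_eq0 => [/allP h|i _]; last exact: sqr_ge0.
apply/rowP => i; rewrite mxE; apply/eqP.
by rewrite -sqrf_eq0; apply: h; rewrite mem_index_enum.
Qed.

Lemma sqnorm_gt0 n (u : 'rV[R]_n) : (0 < sqnorm u) = (u != 0).
Proof. by rewrite lt_neqAle sqnorm_ge0 andbT eq_sym sqnorm_eq0. Qed.

Lemma sqnorm_isometry m n (P : 'M[R]_(m, n)) (c : 'rV[R]_m) :
  P *m P^T = 1%:M -> sqnorm (c *m P) = sqnorm c.
Proof.
move=> PP; have := mulmx_tr_sqnorm (c *m P).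
rewrite trmx_mul mulmxA -(mulmxA c) PP mulmx1 mulmx_tr_sqnorm.
by move/matrixP/(_ 0 0); rewrite !mxE /= !mulr1n.
Qed.

Lemma quadE n (A : 'M[R]_n) (u : 'rV[R]_n) :
  quad A u = \sum_i \sum_j u 0 i * A i j * u 0 j.
Proof.
rewrite /quad mxE exchange_big; apply: eq_bigr => j _ /=.
by rewrite !mxE mulr_suml.
Qed.

Lemma quad_diag n (d u : 'rV[R]_n) :
  quad (diag_mx d) u = \sum_i d 0 i * u 0 i ^+ 2.
Proof.
rewrite /quad mul_mx_diag mxE; apply: eq_bigr => i _.
by rewrite !mxE mulrAC mulrC expr2.
Qed.

(** If x + iy is a complex eigenvector for al + i be, then xA = al x - be y and yA = al y + be x.
    Symmetry equates x A y^T with y A x^T, which leaves be (|x|^2 + |y|^2) = 0, so the eigenvalue is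
    real and x or y is a real eigenvector. *)
Lemma symmetric_real_eigenvector n (A : 'M[R]_n.+1) : A^T = A ->
  exists a (v : 'rV[R]_n.+1), v != 0 /\ v *m A = a *: v.
Proof.
move=> symA; pose AC := map_mx (real_complex R) A.
have [a /eigenvalueP[v vA v0]] : exists a, eigenvalue AC a.
  have /closed_rootP [a ra] : size (char_poly AC) != 1 by rewrite size_char_poly.
  by exists a; rewrite eigenvalue_root_char.
pose x := \row_j complex.Re (v 0 j); pose y := \row_j complex.Im (v 0 j).
set al := complex.Re a; set be := complex.Im a.
have xA : x *m A = al *: x - be *: y.
  apply/rowP => j; have /rowP/(_ j) := vA; rewrite !mxE => /(congr1 (@complex.Re _)).
  rewrite raddf_sum /=; under eq_bigr => k _.
    have -> : complex.Re (v 0 k * AC k j) = x 0 k * A k j.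
      by rewrite !mxE; case: (v 0 k) => b c /=; rewrite mulr0 subr0.
  over.
  by move=> ->; rewrite /al /be; case: (a); case: (v 0 j).
have yA : y *m A = al *: y + be *: x.
  apply/rowP => j; have /rowP/(_ j) := vA; rewrite !mxE => /(congr1 (@complex.Im _)).
  rewrite raddf_sum /=; under eq_bigr => k _.
    have -> : complex.Im (v 0 k * AC k j) = y 0 k * A k j.
      by rewrite !mxE; case: (v 0 k) => b c /=; rewrite mulr0 add0r.
  over.
  by move=> ->; rewrite /al /be; case: (a) => a1 a2; case: (v 0 j) => b c /=.
have xy0 : (x != 0) || (y != 0).
  rewrite -negb_and; apply: contra v0 => /andP[/eqP x0 /eqP y0].
  apply/eqP/rowP => j; move/rowP/(_ j): x0; move/rowP/(_ j): y0.
  by rewrite !mxE; case: (v 0 j) => b c /= -> ->.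
have be0 : be = 0.
  have E : x *m A *m y^T = (y *m A *m x^T)^T.
    by rewrite !trmx_mul trmxK symA mulmxA.
  move: E; rewrite xA yA mulmxBl mulmxDl -!scalemxAl.
  rewrite linearD /= !linearZ /= !trmx_mul !trmxK !mulmx_tr_sqnorm.
  move/matrixP/(_ 0 0); rewrite mxE [X in _ = X]mxE.
  rewrite [X in X + _ = _]mxE [X in _ = X + _]mxE.
  move=> E; have {E} : be * (sqnorm x + sqnorm y) = 0.
    move: E; set z := (x *m y^T) 0 0.
    by rewrite !mxE -/z /= !mulr1n => E; rewrite mulrDr; lra.
  move/eqP; rewrite mulf_eq0 => /orP[/eqP //|].
  rewrite paddr_eq0 ?sqnorm_ge0 // !sqnorm_eq0 => /andP[x0 y0].
  by move: xy0; rewrite x0 y0.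
case/orP: xy0 => nz; [exists al, x|exists al, y]; split=> //.
  by rewrite xA be0 scale0r subr0.
by rewrite yA be0 scale0r addr0.
Qed.

Lemma symmetric_unit_eigenvector n (A : 'M[R]_n.+1) : A^T = A ->
  exists a (v : 'rV[R]_n.+1), sqnorm v = 1 /\ v *m A = a *: v.
Proof.
move=> /symmetric_real_eigenvector[a [v [v0 vA]]].
exists a, ((Num.sqrt (sqnorm v))^-1 *: v); split; last first.
  by rewrite -scalemxAl vA !scalerA mulrC.
rewrite -sqnorm_gt0 in v0.
rewrite /sqnorm; under eq_bigr do rewrite mxE exprMn.
rewrite -mulr_sumr exprVn sqr_sqrtr ?sqnorm_ge0 //.
by rewrite mulVf // gt_eqF.
Qed.

(* The Householder reflection exchanging the unit vector [v] and the first
   basis vector. *)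
Lemma orthogonal_first_row n (v : 'rV[R]_n.+1) : sqnorm v = 1 ->
  exists H : 'M[R]_n.+1, [/\ H^T = H, H *m H = 1%:M & row 0 H = v].
Proof.
move=> v1; pose e : 'rV[R]_n.+1 := delta_mx 0 0.
have [->|ve] := eqVneq v e.
  exists 1%:M; split; rewrite ?trmx1 ?mulmx1 //.
  by apply/rowP => j; rewrite !mxE eqxx /= eq_sym.
have [x xE] : exists x, x = v - e by exists (v - e).
pose s := sqnorm x.
have s0 : s != 0 by rewrite sqnorm_eq0 xE subr_eq0.
have sE : s = 2 - 2 * v 0 0.
  have : x *m x^T = s%:M by rewrite mulmx_tr_sqnorm.
  have ee : e *m e^T = 1%:M.
    by rewrite trmx_delta mul_delta_mx; apply/rowP => i; rewrite ord1 !mxE eqxx.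
  have ve0 : v *m e^T = (v 0 0)%:M.
    apply/rowP => i; rewrite ord1 trmx_delta !mxE (bigD1 0) //= !mxE !eqxx mulr1.
    by rewrite big1 ?addr0 // => k k0; rewrite !mxE (negbTE k0) mulr0.
  have ev : e *m v^T = (v 0 0)%:M.
    by rewrite -[e]trmxK -trmx_mul ve0 tr_scalar_mx.
  rewrite xE linearB /= mulmxBl !mulmxBr ve0 ev ee mulmx_tr_sqnorm v1.
  by move/matrixP/(_ 0 0); rewrite !mxE /=; lra.
exists (1%:M - (2 / s) *: (x^T *m x)); split.
- by rewrite linearB /= linearZ /= trmx1 trmx_mul trmxK.
- rewrite mulmxBl mul1mx mulmxBr mulmx1 -scalemxAl -scalemxAr scalerA.
  rewrite mulmxA -(mulmxA x^T x) mulmx_tr_sqnorm -/s mul_mx_scalar -scalemxAl.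
  rewrite scalerA.
  have -> : 2 / s * (2 / s) * s = 2 / s + 2 / s by field.
  by rewrite scalerDl opprB addrK subrK.
- apply/rowP => j; rewrite !mxE big_ord1 !mxE.
  rewrite xE !mxE eqxx /=.
  have -> : v 0 0 - 1 = - s / 2 by rewrite sE; field.
  rewrite (eq_sym j) mulrA.
  have -> : 2 / s * (- s / 2) = -1 by field.
  by rewrite mulN1r opprK addrC subrK.
Qed.

(** Conjugating by a reflection whose first row is a unit eigenvector makes the first row of the
    matrix a multiple of the first basis vector. By symmetry so is the first column, and the
    induction runs on the remaining block. *)
Lemma spectral_theorem n (A : 'M[R]_n) : A^T = A ->
  exists (P : 'M[R]_n) (d : 'rV[R]_n),
    P *m P^T = 1%:M /\ A = P^T *m diag_mx d *m P.
Proof.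
elim: n A => [|n IHn] A symA.
  by exists 1%:M, 0; split; apply/matrixP => -[].
have [a [v [v1 vA]]] := symmetric_unit_eigenvector symA.
have [H [HT HH Hv]] := orthogonal_first_row v1.
have [B BE] : exists B, B = H *m A *m H by exists (H *m A *m H).
have symB : B^T = B by rewrite BE !trmx_mul HT symA mulmxA.
have B0 : row 0 B = a *: delta_mx 0 0.
  rewrite BE !row_mul Hv vA -scalemxAl -Hv -row_mul HH.
  by congr (_ *: _); apply/rowP => j; rewrite !mxE eqxx eq_sym.
pose B' : 'M[R]_(1 + n) := B.
have blkB : B' = block_mx a%:M 0 0 (drsubmx B').
  rewrite -[LHS]submxK; congr block_mx.
  - apply/matrixP => i j; rewrite !ord1 !mxE /= mulr1n.
    move/rowP/(_ 0): B0; rewrite !mxE eqxx mulr1 => <-.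
    by congr (B _ _); apply: val_inj.
  - apply/matrixP => i j; rewrite !ord1 !mxE /=.
    move/rowP/(_ (rshift 1 j)): B0; rewrite !mxE /= mulr0 => <-.
    by congr (B _ _); apply: val_inj.
  - apply/matrixP => i j; rewrite !ord1 !mxE /= /B' -symB mxE.
    move/rowP/(_ (rshift 1 i)): B0; rewrite !mxE /= mulr0 => <-.
    by congr (B _ _); apply: val_inj.
have [|P [d [PP dr]]] := IHn (drsubmx B').
  rewrite trmx_drsub; congr drsubmx; exact: symB.
pose P' : 'M[R]_(1 + n) := block_mx 1%:M 0 0 P.
pose d' : 'rV[R]_(1 + n) := row_mx a%:M d.
have PP' : P' *m P'^T = 1%:M.
  rewrite tr_block_mx mulmx_block !trmx0 trmx1.
  by rewrite !mulmx0 !mul0mx !mul1mx !addr0 add0r PP -scalar_mx_block.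
have BP' : B' = P'^T *m diag_mx d' *m P'.
  rewrite blkB diag_mx_row (_ : diag_mx a%:M = a%:M); last first.
    by apply/matrixP => i j; rewrite !ord1 !mxE.
  rewrite tr_block_mx !trmx0 trmx1 !mulmx_block.
  by rewrite !mulmx0 !mul0mx !mulmx1 !mul1mx !addr0 !add0r dr mul0mx.
have AB : A = H *m B *m H.
  by rewrite BE !mulmxA HH mul1mx -mulmxA HH mulmx1.
exists ((P' : 'M[R]_n.+1) *m H), d'; split.
  by rewrite trmx_mul HT mulmxA -(mulmxA (P' : 'M[R]_n.+1) H H) HH mulmx1.
rewrite trmx_mul HT AB.
have E : B = P'^T *m diag_mx d' *m P' by exact: BP'.
by rewrite E !mulmxA.
Qed.

Lemma sorting_permutation n (d : 'rV[R]_n) :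
  exists s : 'S_n, forall i j : 'I_n, (i <= j)%N -> d 0 (s j) <= d 0 (s i).
Proof.
pose t := [tuple d 0 i | i < n].
have ge_total : total (fun x y : R => y <= x) by move=> x y; exact: le_total.
have ge_trans : transitive (fun x y : R => y <= x).
  by move=> y x z h1 h2; exact: le_trans h2 h1.
pose t' := [tuple of sort (fun x y => y <= x) t].
have /tuple_permP[s ss] : perm_eq t' t by rewrite perm_sort.
exists s => i j ij.
have tE (k : 'I_n) : d 0 (s k) = tnth t' k.
  rewrite (tnth_nth 0) [X in nth _ X]ss.
  by rewrite -tnth_nth tnth_mktuple tnth_mktuple.
rewrite !tE !(tnth_nth 0).
have so : sorted (fun x y : R => y <= x) t' by exact: sort_sorted.
apply: (sorted_leq_nth ge_trans _ 0 so) => //; rewrite ?inE ?size_tuple //.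
Qed.

Lemma sorted_spectral_theorem n (A : 'M[R]_n) : A^T = A ->
  exists (P : 'M[R]_n) (d : 'rV[R]_n),
    [/\ P *m P^T = 1%:M, A = P^T *m diag_mx d *m P &
        forall i j : 'I_n, (i <= j)%N -> d 0 j <= d 0 i].
Proof.
move=> /spectral_theorem[P [d [PP AE]]].
have [s ds] := sorting_permutation d.
exists (row_perm s P), (col_perm s d); split.
- rewrite tr_row_perm row_permE col_permE.
  by rewrite mulmxA -(mulmxA _ P) PP mulmx1 -perm_mxM mulgV perm_mx1.
- rewrite {1}AE; apply/matrixP => i j.
  rewrite -!mulmxA !mul_diag_mx ![LHS]mxE ![RHS]mxE.
  rewrite (reindex_inj (@perm_inj _ s)) /=; apply: eq_bigr => k _.
  by rewrite !mxE.
- by move=> i j ij; rewrite !mxE; exact: ds.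
Qed.

End Spectral.

(** * Comparison of eigenvalues and traces *)

Section Diagonalized.
Variables (R : rcfType) (n : nat) (A P : 'M[R]_n) (d : 'rV[R]_n).
Hypotheses (PP : P *m P^T = 1%:M) (AE : A = P^T *m diag_mx d *m P).

Lemma diagonalized_pow k : A ^+ k = P^T *m diag_mx (\row_i d 0 i ^+ k) *m P.
Proof.
elim: k => [|k IHk].
  rewrite expr0 (_ : diag_mx _ = 1%:M) ?mulmx1; last first.
    by apply/matrixP => i j; rewrite !mxE expr0.
  by rewrite (mulmx1C PP).
rewrite exprSr IHk {1}AE -mulmxE !mulmxA -(mulmxA _ P) PP mulmx1.
rewrite -(mulmxA P^T) mulmx_diag; congr (_ *m diag_mx _ *m _).
by apply/rowP => i; rewrite !mxE exprSr.
Qed.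

Lemma diagonalized_trace k : \tr (A ^+ k) = \sum_i d 0 i ^+ k.
Proof.
rewrite diagonalized_pow -mulmxA mxtrace_mulC -mulmxA PP mulmx1 mxtrace_diag.
by apply: eq_bigr => i _; rewrite mxE.
Qed.

Lemma diagonalized_quad u :
  quad A u = \sum_i d 0 i * (u *m P^T) 0 i ^+ 2.
Proof.
rewrite -quad_diag /quad AE; congr (fun_of_matrix _ 0 0).
by rewrite trmx_mul trmxK !mulmxA.
Qed.

Lemma diagonalized_sqnorm u : sqnorm (u *m P^T) = sqnorm u.
Proof. by apply: sqnorm_isometry; rewrite trmxK (mulmx1C PP). Qed.

Lemma diagonalized_quad_row i : quad A (row i P) = d 0 i.
Proof.
have E : row i P *m P^T = delta_mx 0 i by rewrite -row_mul PP row1.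
rewrite diagonalized_quad E (bigD1 i) //= mxE !eqxx expr1n mulr1.
by rewrite big1 ?addr0 // => j ji; rewrite mxE (negbTE ji) andbF expr0n mulr0.
Qed.

Lemma diagonalized_sqnorm_row i : sqnorm (row i P) = 1.
Proof.
have E : row i P *m P^T = delta_mx 0 i by rewrite -row_mul PP row1.
rewrite -diagonalized_sqnorm E /sqnorm (bigD1 i) //= mxE !eqxx expr1n.
by rewrite big1 ?addr0 // => j ji; rewrite mxE (negbTE ji) andbF expr0n.
Qed.

(** The diagonal entry is the average of the [d 0 j ^+ k] with weights [P j i ^+ 2], which sum to 1
    because P^T P = 1. *)
Lemma diagonalized_pow_diag_le rho k i :
  (forall j, `|d 0 j| <= rho) -> (A ^+ k) i i <= rho ^+ k.
Proof.
move=> dr; rewrite diagonalized_pow -mulmxA mul_diag_mx mxE.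
have rho0 : 0 <= rho by exact: le_trans (normr_ge0 _) (dr i).
apply: (@le_trans _ _ (\sum_j rho ^+ k * P j i ^+ 2)).
  apply: ler_sum => j _; rewrite !mxE mulrCA -expr2.
  apply: ler_wpM2r; first exact: sqr_ge0.
  apply: le_trans (ler_norm _) _; rewrite normrX.
  by apply: lerXn2r; rewrite ?nnegrE.
rewrite -mulr_sumr; have /matrixP/(_ i i) := mulmx1C PP; rewrite !mxE eqxx.
under eq_bigr do rewrite mxE -expr2.
by move=> ->; rewrite mulr1.
Qed.

(* A matrix with nonnegative entries has its spectral radius as top
   eigenvalue, so an upper bound on the quadratic form suffices. *)
Lemma diagonalized_norm_le rho : (forall i j, 0 <= A i j) ->
  (forall u, quad A u <= rho * sqnorm u) -> forall i, `|d 0 i| <= rho.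
Proof.
move=> A0 Ar i; rewrite -diagonalized_quad_row.
pose v : 'rV[R]_n := \row_j `|row i P 0 j|.
have v1 : sqnorm v = 1.
  rewrite -(diagonalized_sqnorm_row i); apply: eq_bigr => j _.
  by rewrite mxE real_normK // num_real.
apply: le_trans (_ : quad A v <= _); last by rewrite (le_trans (Ar v)) // v1 mulr1.
rewrite !quadE; apply: le_trans (ler_norm_sum _ _ _) _.
apply: ler_sum => j _; apply: le_trans (ler_norm_sum _ _ _) _.
by apply: ler_sum => k _; rewrite !normrM [v 0 j]mxE [v 0 k]mxE (ger0_norm (A0 _ _)).
Qed.

End Diagonalized.

Section Comparison.
Variable R : rcfType.

(** For -1 <= d <= 0 the even power is at most -d^(2n+1). Nonnegativity of the odd sum bounds the
    total of these by the sum over the positive d, whence the factor 2. *)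
Lemma sum_even_powers_le (J : finType) (d : J -> R) n :
  (forall i, `|d i| <= 1) -> 0 <= \sum_i d i ^+ (2 * n).+1 ->
  \sum_i d i ^+ (2 * n).+2 <= 2 * \sum_(i | 0 < d i) d i ^+ (2 * n).+1.
Proof.
move=> d1; rewrite (bigID (fun i => 0 < d i)) /= => tr0.
rewrite (bigID (fun i => 0 < d i)) /= mulr_natl mulr2n.
apply: lerD.
  apply: ler_sum => i di; rewrite exprSr ler_piMr ?exprn_ge0 ?(ltW di) //.
  by apply: le_trans (d1 i); exact: ler_norm.
apply: le_trans (_ : - \sum_(i | ~~ (0 < d i)) d i ^+ (2 * n).+1 <= _).
  rewrite -sumrN; apply: ler_sum => i; rewrite -leNgt => di.
  have h : 0 <= - d i by rewrite oppr_ge0.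
  rewrite -subr_ge0 (_ : _ - _ = (- d i) ^+ (2 * n).+1 * (1 + d i)); last first.
    by rewrite [(- d i) ^+ _]exprNn -signr_odd /= oddM /= expr1 [d i ^+ (2 * n).+2]exprSr; ring.
  apply: mulr_ge0; first exact: exprn_ge0.
  by have := d1 i; rewrite ler_norml => /andP[]; lra.
by rewrite -subr_ge0 opprK.
Qed.

Lemma bernoulli_upper (x : R) k : 0 <= x <= 1 -> (1 - x) ^+ k * (1 + x *+ k) <= 1.
Proof.
move=> /andP[x0 x1]; elim: k => [|k IHk]; first by rewrite expr0 mulr0n addr0 mulr1.
apply: le_trans IHk; rewrite exprSr -mulrA ler_wpM2l ?exprn_ge0 ?subr_ge0 //.
have : 0 <= x *+ k by apply: mulrn_wge0.
rewrite mulrS; nra.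
Qed.

(** It suffices that (1 - x)^M <= 1 - D x. By [bernoulli_upper] the left side is at most 1 / (1 + M
    x), and (1 - D x)(1 + M x) >= 1 follows from M >= 2D and D x <= 1/2. *)
Lemma pow_rescale (x D : R) (M p q : nat) :
  0 <= x -> 1 <= D -> D * x <= 2^-1 -> 2 * D <= M%:R -> (M * q <= p)%N ->
  (1 - x) ^+ p <= (1 - D * x) ^+ q.
Proof.
move=> x0 D1 Dx DM Mqp.
have x1 : x <= 2^-1 by apply: le_trans Dx; nra.
have b : 0 <= 1 - x <= 1 by lra.
apply: le_trans (_ : (1 - x) ^+ (M * q) <= _).
  have [b0 b1] := andP b; exact: ler_wiXn2l.
rewrite exprM; apply: lerXn2r; rewrite ?nnegrE ?exprn_ge0 //; [lra|lra|].
have y0 : 0 <= x <= 1 by lra.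
have := bernoulli_upper M y0; rewrite -mulr_natr.
have : 0 <= (1 - x) ^+ M by apply: exprn_ge0; lra.
move: (_ ^+ M) => Y Y0 Yb.
have h : 1 <= (1 - D * x) * (1 + x * M%:R).
  have : 0 <= x * (M%:R - 2 * D) by apply: mulr_ge0; lra.
  have : 0 <= x * M%:R * (2^-1 - D * x).
    by apply: mulr_ge0; [apply: mulr_ge0; lra|lra].
  nra.
have t0 : 0 < 1 + x * M%:R.
  have : 0 <= x * M%:R by apply: mulr_ge0; lra.
  lra.
rewrite -(ler_pM2r t0); exact: le_trans Yb h.
Qed.

Section TwoMatrices.
Variables (m n : nat) (A P : 'M[R]_m) (d : 'rV[R]_m) (B Q : 'M[R]_n) (e : 'rV[R]_n).
Hypotheses (PP : P *m P^T = 1%:M) (AE : A = P^T *m diag_mx d *m P).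
Hypotheses (QQ : Q *m Q^T = 1%:M) (BE : B = Q^T *m diag_mx e *m Q).
Hypothesis d_sorted : forall i j : 'I_m, (i <= j)%N -> d 0 j <= d 0 i.
Hypothesis e_sorted : forall i j : 'I_n, (i <= j)%N -> e 0 j <= e 0 i.
Variables (W : 'M[R]_(m, n)) (delta D : R).
Hypothesis transfer : forall t u, t <= delta -> u != 0 ->
  (1 - t) * sqnorm u <= quad A u ->
  u *m W != 0 /\ (1 - D * t) * sqnorm (u *m W) <= quad B (u *m W).

(* Courant-Fischer: the span of the first [k+1] eigenvectors of [A] has an
   element whose image under [W] is orthogonal to the first [k] eigenvectors
   of [B]. *)
Lemma eigenvalue_transfer (k : 'I_m) : 1 - delta <= d 0 k ->
  exists hk : (k < n)%N, 1 - D * (1 - d 0 k) <= e 0 (Ordinal hk).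
Proof.
move=> dk.
pose f : 'I_k.+1 -> 'I_m := widen_ord (ltn_ord k).
pose Pk := rowsub f P.
(* Column j is the j-th eigenvector of [B], or zero when j >= n: the sum over l = j encodes this
   without presupposing k <= n, which is only derived at the end. *)
pose Y : 'M[R]_(n, k) := \matrix_(i, j) \sum_(l < n | l == j :> nat) Q l i.
have PkPk : Pk *m Pk^T = 1%:M.
  apply/matrixP => i j; have /matrixP/(_ (f i) (f j)) := PP; rewrite !mxE.
  rewrite -[f i == f j]/(i == j) => <-.
  by apply: eq_bigr => l _; rewrite !mxE.
have [c c0 cM] : exists2 c : 'rV_k.+1, c != 0 & c *m (Pk *m W *m Y) = 0.
  have : kermx (Pk *m W *m Y) != 0.
    rewrite kermx_eq0 /row_free; apply/eqP => rk.
    by have := rank_leq_col (Pk *m W *m Y); rewrite rk ltnn.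
  by case/rowV0Pn => c /sub_kermxP cM c0; exists c.
have u0 : c *m Pk != 0 by rewrite -sqnorm_gt0 sqnorm_isometry // sqnorm_gt0.
have Au : (1 - (1 - d 0 k)) * sqnorm (c *m Pk) <= quad A (c *m Pk).
  have -> : quad A (c *m Pk) = quad (Pk *m A *m Pk^T) c.
    by rewrite /quad trmx_mul !mulmxA.
  have -> : Pk *m A *m Pk^T = diag_mx (\row_i d 0 (f i)).
    have PkP : Pk *m P^T = \matrix_(i, j) (f i == j)%:R.
      apply/matrixP => i j; have /matrixP/(_ (f i) j) := PP; rewrite !mxE => <-.
      by apply: eq_bigr => l _; rewrite !mxE.
    rewrite AE !mulmxA PkP -mulmxA -[P *m _]trmxK trmx_mul trmxK PkP.
    apply/matrixP => i j; rewrite mul_mx_diag !mxE (bigD1 (f i)) //= !mxE eqxx mul1r.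
    rewrite big1 ?addr0 => [|l /negbTE li]; last by rewrite !mxE eq_sym li !mul0r.
    by rewrite -[f j == f i]/(j == i) eq_sym mulr_natr.
  rewrite quad_diag sqnorm_isometry // mulr_sumr; apply: ler_sum => i _.
  rewrite mxE subKr; apply: ler_wpM2r; first exact: sqr_ge0.
  by apply: d_sorted; rewrite /= -ltnS.
have [|w0 Bw] := transfer _ u0 Au; first by lra.
have wY : c *m Pk *m W *m Y = 0 by rewrite -!mulmxA mulmxA in cM *.
move: (c *m Pk *m W) w0 Bw wY => w w0 Bw wY.
have zl (l : 'I_n) : (l < k)%N -> (w *m Q^T) 0 l = 0.
  move=> lk; move/rowP/(_ (Ordinal lk)): wY; rewrite !mxE => E; rewrite -[RHS]E.
  apply: eq_bigr => i _; rewrite !mxE; congr (_ * _).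
  rewrite (bigD1 l) //= big1 ?addr0 // => j /andP[/eqP jl].
  by rewrite -val_eqE /= jl eqxx.
have z0 : 0 < sqnorm (w *m Q^T) by rewrite (diagonalized_sqnorm QQ) sqnorm_gt0.
have hk : (k < n)%N.
  rewrite ltnNge; apply/negP => nk; move: z0; rewrite lt_neqAle => /andP[/eqP[]].
  rewrite /sqnorm big1 // => l _; rewrite zl ?expr0n //.
  exact: leq_trans (ltn_ord l) nk.
exists hk; rewrite -(ler_pM2r z0) [X in X <= _](_ : _ = (1 - D * (1 - d 0 k)) * sqnorm w); last first.
  by rewrite (diagonalized_sqnorm QQ).
apply: le_trans Bw _; rewrite (diagonalized_quad BE) mulr_sumr.
apply: ler_sum => l _; have [lk|kl] := ltnP l k.
  by rewrite zl // expr0n !mulr0.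
by apply: ler_wpM2r; [exact: sqr_ge0|exact: e_sorted].
Qed.

(** Eigenvalues of [A] below 1 - delta contribute at most (1 - delta)^p each. The others are matched
    with the eigenvalues of [B] of the same index, hence injectively, and the even exponent makes
    the unmatched part of the trace of [B] nonnegative. *)
Lemma transfer_power_sum (M p q : nat) :
  0 <= delta -> 1 <= D -> 2 * D * delta <= 1 -> 2 * D <= M%:R ->
  (M * (2 * q) <= p)%N -> (forall i, `|d 0 i| <= 1) ->
  \sum_(i | 0 < d 0 i) d 0 i ^+ p <= m%:R * (1 - delta) ^+ p + \tr (B ^+ (2 * q)).
Proof.
move=> delta0 D1 Ddelta DM Mqp d1.
have delta1 : delta <= 1 by nra.
rewrite (diagonalized_trace QQ BE) (bigID (fun i => d 0 i < 1 - delta)) /=.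
apply: lerD.
  apply: (@le_trans _ _ (\sum_(i < m) (1 - delta) ^+ p)); last first.
    by rewrite sumr_const card_ord mulr_natl.
  rewrite [leRHS](bigID (fun i => (0 < d 0 i) && (d 0 i < 1 - delta))) /=.
  rewrite -[leLHS]addr0; apply: lerD.
    apply: ler_sum => i /andP[di0 di]; apply: lerXn2r; rewrite ?nnegrE ?subr_ge0 ?(ltW di0) //.
    exact: ltW.
  by apply: sumr_ge0 => i _; apply: exprn_ge0; rewrite subr_ge0.
have step (i : 'I_m) : 1 - delta <= d 0 i ->
    exists hi : (i < n)%N, d 0 i ^+ p <= e 0 (Ordinal hi) ^+ (2 * q).
  move=> di; have [hi ei] := eigenvalue_transfer di; exists hi.
  have di1 : d 0 i <= 1 by apply: le_trans (d1 i); exact: ler_norm.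
  have Dd : D * (1 - d 0 i) <= 2^-1.
    have : D * (1 - d 0 i) <= D * delta by apply: ler_wpM2l; lra.
    lra.
  apply: le_trans (_ : (1 - D * (1 - d 0 i)) ^+ (2 * q) <= _).
    rewrite -[X in X ^+ p <= _](subKr 1); apply: (@pow_rescale _ _ M) => //; lra.
  by apply: lerXn2r; rewrite ?nnegrE //; lra.
(* The total map [F] below needs a default index. For n = 0 no eigenvalue of [A] reaches 1 - delta,
   since [step] would place its index below n. *)
have [n0|n_gt0] := posnP n.
  rewrite big1 => [|i /andP[_]]; last first.
    by rewrite -leNgt => /step[hi]; have := hi; rewrite {1}n0.
  apply: sumr_ge0 => i _; rewrite exprM; apply: exprn_ge0; exact: sqr_ge0.
pose j0 : 'I_n := Ordinal n_gt0.
pose F (i : 'I_m) : 'I_n := insubd j0 (val i).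
pose C := [set i : 'I_m | (0 < d 0 i) && ~~ (d 0 i < 1 - delta)]%SET.
have FE i : i \in C -> exists2 hi : (i < n)%N, F i = Ordinal hi & d 0 i ^+ p <= e 0 (F i) ^+ (2 * q).
  rewrite inE -leNgt => /andP[_ /step[hi ei]]; exists hi.
    by apply: val_inj; rewrite /F val_insubd hi.
  by rewrite (_ : F i = Ordinal hi) //; apply: val_inj; rewrite /F val_insubd hi.
have Finj : {in C &, injective F}.
  move=> i j /FE[hi Fi _] /FE[hj Fj _]; rewrite Fi Fj => -[] ij; exact: val_inj.
rewrite (eq_bigl (fun i => i \in C)); last by move=> i; rewrite inE.
apply: le_trans (_ : \sum_(i in C) e 0 (F i) ^+ (2 * q) <= _).
  by apply: ler_sum => i /FE[].
rewrite -(big_imset (fun j => e 0 j ^+ (2 * q)) Finj) /= [leRHS](bigID (fun j => j \in F @: C)%SET) /= lerDl.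
apply: sumr_ge0 => i _; rewrite exprM; apply: exprn_ge0; exact: sqr_ge0.
Qed.

End TwoMatrices.
End Comparison.

Section TraceTheorems.
Variable R : rcfType.

Lemma expmx_ge0 n (A : 'M[R]_n) k : (forall i j, 0 <= A i j) ->
  forall i j, 0 <= (A ^+ k) i j.
Proof.
move=> A0; elim: k => [|k IHk] i j; first by rewrite expr0 mxE; case: eqP.
by rewrite exprSr mxE; apply: sumr_ge0 => l _; rewrite mulr_ge0.
Qed.

Lemma expmx_diag_le n (A : 'M[R]_n) rho k i : A^T = A ->
  (forall i j, 0 <= A i j) -> (forall u, quad A u <= rho * sqnorm u) ->
  (A ^+ k) i i <= rho ^+ k.
Proof.
move=> /spectral_theorem[P [d [PP AE]]] A0 Ar.
apply: (diagonalized_pow_diag_le PP AE) => j.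
exact: (diagonalized_norm_le PP AE).
Qed.

(** Some eigenvalue is at least 1: if all were smaller, the quadratic form would be strictly below
    the norm at every nonzero vector. Used for finite groups, where the constant function is the
    test vector. *)
Lemma trace_even_power_ge1 n (B : 'M[R]_n) u q : B^T = B -> u != 0 ->
  sqnorm u <= quad B u -> 1 <= \tr (B ^+ (2 * q)).
Proof.
move=> /spectral_theorem[Q [e [QQ BE]]] u0 uB.
have [/existsP[i ei]|] := boolP [exists i, 1 <= e 0 i].
  rewrite (diagonalized_trace QQ BE) (bigD1 i) //= -[leLHS]addr0; apply: lerD.
    exact: exprn_ege1.
  by apply: sumr_ge0 => j _; rewrite exprM exprn_ge0 ?sqr_ge0.
rewrite negb_exists => /forallP e1.
move: uB; rewrite (diagonalized_quad BE) -(diagonalized_sqnorm QQ) leNgt => /negP[].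
have : sqnorm (u *m Q^T) != 0.
  by rewrite (diagonalized_sqnorm QQ) sqnorm_eq0.
rewrite /sqnorm => h; rewrite lt_neqAle; apply/andP; split; last first.
  apply: ler_sum => i _; apply: ler_piMl; first exact: sqr_ge0.
  by apply: ltW; rewrite ltNge.
apply: contra h => /eqP E; rewrite psumr_eq0 => [|i _]; last exact: sqr_ge0.
have : \sum_i (1 - e 0 i) * (u *m Q^T) 0 i ^+ 2 == 0.
  by under eq_bigr do rewrite mulrBl mul1r; rewrite sumrB E subrr.
have e1' i : 0 < 1 - e 0 i by rewrite subr_gt0 ltNge.
rewrite psumr_eq0 => [/allP a|i _]; last by rewrite mulr_ge0 ?sqr_ge0 // ltW.
apply/allP => i /a /=; rewrite mulf_eq0 => /orP[|//].
by rewrite gt_eqF.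
Qed.

(** Nonnegative entries of [A] serve twice: they turn the upper bound on the quadratic form into
    |eigenvalue| <= 1, and they make the trace of the odd power nonnegative. *)
Lemma trace_comparison m n (A : 'M[R]_m) (B : 'M[R]_n) (W : 'M[R]_(m, n))
    (delta D : R) (M q k : nat) :
  A^T = A -> B^T = B -> (forall i j, 0 <= A i j) ->
  (forall u, quad A u <= sqnorm u) ->
  (forall t u, t <= delta -> u != 0 -> (1 - t) * sqnorm u <= quad A u ->
     u *m W != 0 /\ (1 - D * t) * sqnorm (u *m W) <= quad B (u *m W)) ->
  0 <= delta -> 1 <= D -> 2 * D * delta <= 1 -> 2 * D <= M%:R ->
  (M * (2 * q) <= (2 * k).+1)%N ->
  \tr (A ^+ (2 * k).+2) <=
    2 * (m%:R * (1 - delta) ^+ (2 * k).+1 + \tr (B ^+ (2 * q))).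
Proof.
move=> symA symB A0 A1 AB d0 D1 Dd DM Mq.
have [P [d [PP AE ds]]] := sorted_spectral_theorem symA.
have [Q [e [QQ BE es]]] := sorted_spectral_theorem symB.
have d1 i : `|d 0 i| <= 1.
  by apply: (diagonalized_norm_le PP AE) => // u; rewrite mul1r.
apply: le_trans (_ : 2 * \sum_(i | 0 < d 0 i) d 0 i ^+ (2 * k).+1 <= _).
  rewrite (diagonalized_trace PP AE); apply: sum_even_powers_le => //.
  rewrite -(diagonalized_trace PP AE).
  by apply: sumr_ge0 => i _; exact: expmx_ge0.
rewrite ler_pM2l //.
exact: (transfer_power_sum PP AE QQ BE ds es AB d0 D1 Dd DM Mq).
Qed.

End TraceTheorems.

(** * Truncated kernels as symmetric matrices *)

Section Truncation.
Variables (R : rcfType) (X : eqType).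
Implicit Types (p : X -> X -> R) (m u : X -> R) (s : seq X).

(** The walk killed on leaving [s]. All positions but the last are constrained; the endpoint [b] is
    free, so that the recursion has the same shape as that of [kernel_pow]. *)
Fixpoint trunc_pow p s n (a b : X) : R :=
  if n is n'.+1 then \sum_(c <- s) trunc_pow p s n' a c * p c b
  else (a == b)%:R.

Definition wnorm m s u : R := \sum_(a <- s) m a * u a ^+ 2.

Definition wform m p s u : R :=
  \sum_(a <- s) \sum_(b <- s) m a * p a b * (u a * u b).

Section Symmetrization.
Variables (p : X -> X -> R) (m : X -> R) (s : seq X).
Hypotheses (p0 : forall a b, 0 <= p a b) (m0 : forall a, 0 < m a).
Hypothesis rev : forall a b, m a * p a b = p b a * m b.
Hypothesis s_uniq : uniq s.

Let r a := Num.sqrt (m a).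
Let r0 a : 0 < r a. Proof. by rewrite sqrtr_gt0. Qed.
Let r_neq0 a : r a != 0. Proof. by rewrite gt_eqF. Qed.
Let rr a : r a ^+ 2 = m a. Proof. by rewrite sqr_sqrtr // ltW. Qed.
Let el (i : 'I_(size s)) := tnth (in_tuple s) i.
Let el_inj : injective el. Proof. exact/tuple_uniqP. Qed.

(** The truncated kernel conjugated by the square root of the weight. Reversibility makes it
    symmetric, and diagonal entries of its powers are unaffected by the conjugation. *)
Definition symmetrized : 'M[R]_(size s) :=
  \matrix_(i, j) (Num.sqrt (m (tnth (in_tuple s) i)) *
                  p (tnth (in_tuple s) i) (tnth (in_tuple s) j) /
                  Num.sqrt (m (tnth (in_tuple s) j))).

Lemma symmetrized_tr : symmetrized^T = symmetrized.
Proof.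
apply/matrixP => i j; rewrite !mxE -/(el i) -/(el j) -/(r (el i)) -/(r (el j)).
have : r (el j) ^+ 2 * p (el j) (el i) = p (el i) (el j) * r (el i) ^+ 2.
  by rewrite !rr rev.
move=> E; apply: (mulfI (r_neq0 (el j))); apply: (mulIf (r_neq0 (el i))).
rewrite mulrA mulrA -expr2 E mulfVK // .
by field.
Qed.

Lemma symmetrized_ge0 i j : 0 <= symmetrized i j.
Proof. by rewrite mxE mulr_ge0 ?invr_ge0 ?mulr_ge0 ?sqrtr_ge0. Qed.

Lemma symmetrized_pow k i j :
  (symmetrized ^+ k) i j =
  r (el i) * trunc_pow p s k (el i) (el j) / r (el j).
Proof.
elim: k i j => [|k IHk] i j.
  rewrite expr0 mxE /= (inj_eq el_inj); case: eqP => [->|_]; rewrite ?mulr1 ?mulr0 ?mul0r //.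
  by rewrite divff.
rewrite exprSr mxE /= [in RHS]big_tnth mulr_sumr mulr_suml; apply: eq_bigr => l _.
by rewrite IHk mxE -/(el l) -/(r (el l)) -/(el j) -/(r (el j)); field; rewrite !r_neq0.
Qed.

Lemma symmetrized_trace k :
  \tr (symmetrized ^+ k) = \sum_(a <- s) trunc_pow p s k a a.
Proof.
rewrite /mxtrace [RHS]big_tnth; apply: eq_bigr => i _; rewrite symmetrized_pow.
by rewrite mulrAC divff // mul1r.
Qed.

Definition wvec u : 'rV[R]_(size s) :=
  \row_i (Num.sqrt (m (tnth (in_tuple s) i)) * u (tnth (in_tuple s) i)).

Lemma sqnorm_wvec u : sqnorm (wvec u) = wnorm m s u.
Proof.
by rewrite /wnorm [RHS]big_tnth; apply: eq_bigr => i _; rewrite mxE exprMn rr.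
Qed.

Lemma quad_symmetrized u : quad symmetrized (wvec u) = wform m p s u.
Proof.
rewrite quadE /wform [RHS]big_tnth; apply: eq_bigr => i _.
rewrite [RHS]big_tnth; apply: eq_bigr => j _; rewrite !mxE.
rewrite -/(el i) -/(r (el i)) -/(el j) -/(r (el j)) -(rr (el i)); field.
exact: r_neq0.
Qed.

Lemma wvec_surj (v : 'rV[R]_(size s)) :
  exists2 u, (forall a, a \notin s -> u a = 0) & wvec u = v.
Proof.
pose u a := \sum_i (el i == a)%:R * v 0 i / r a.
exists u => [a as0|].
  apply: big1 => i _; rewrite (_ : (el i == a) = false) ?mul0r //.
  by apply: contraNF as0 => /eqP <-; exact: mem_tnth.
apply/rowP => i; rewrite mxE -/(el i) -/(r (el i)) /u (bigD1 i) //= eqxx mul1r.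
rewrite big1 ?addr0 => [|j ji]; first by rewrite mulrCA divff ?mulr1.
by rewrite (inj_eq el_inj) (negbTE ji) !mul0r.
Qed.

Lemma trunc_pow_diag_le rho k a : a \in s ->
  (forall u, (forall a, a \notin s -> u a = 0) ->
     wform m p s u <= rho * wnorm m s u) ->
  trunc_pow p s k a a <= rho ^+ k.
Proof.
move=> as0 H; have /tnthP[i ->] : a \in in_tuple s by [].
have := symmetrized_pow k i i; rewrite mulrAC divff // mul1r => <-.
apply: expmx_diag_le => [||v]; [exact: symmetrized_tr|exact: symmetrized_ge0|].
by have [u us <-] := wvec_surj v; rewrite quad_symmetrized sqnorm_wvec H.
Qed.

Lemma trunc_trace_ge1 u k : 0 < wnorm m s u -> wnorm m s u <= wform m p s u ->
  1 <= \sum_(a <- s) trunc_pow p s (2 * k) a a.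
Proof.
move=> u0 uu; rewrite -symmetrized_trace.
apply: (@trace_even_power_ge1 _ _ _ (wvec u)).
- exact: symmetrized_tr.
- by rewrite -sqnorm_gt0 sqnorm_wvec.
- by rewrite sqnorm_wvec quad_symmetrized.
Qed.

End Symmetrization.
End Truncation.

Section TraceTransfer.
Variables (R : rcfType) (X Y : eqType).
Variables (p : X -> X -> R) (m : X -> R) (q : Y -> Y -> R) (m' : Y -> R).
Variables (s : seq X) (t : seq Y) (phi : Y -> X).

Lemma trunc_trace_comparison (delta D : R) (M l k : nat) :
  (forall a b, 0 <= p a b) -> (forall a, 0 < m a) ->
  (forall a b, m a * p a b = p b a * m b) -> uniq s ->
  (forall b, 0 < m' b) ->
  (forall a b, m' a * q a b = q b a * m' b) -> uniq t ->
  (forall b, b \in t -> phi b \in s) ->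
  (forall u, (forall a, a \notin s -> u a = 0) -> wform m p s u <= wnorm m s u) ->
  (forall tau u, (forall a, a \notin s -> u a = 0) ->
     tau <= delta -> 0 < wnorm m s u ->
     (1 - tau) * wnorm m s u <= wform m p s u ->
     0 < wnorm m' t (u \o phi) /\
     (1 - D * tau) * wnorm m' t (u \o phi) <= wform m' q t (u \o phi)) ->
  0 <= delta -> 1 <= D -> 2 * D * delta <= 1 -> 2 * D <= M%:R ->
  (M * (2 * l) <= (2 * k).+1)%N ->
  \sum_(a <- s) trunc_pow p s (2 * k).+2 a a <=
    2 * ((size s)%:R * (1 - delta) ^+ (2 * k).+1 +
         \sum_(b <- t) trunc_pow q t (2 * l) b b).
Proof.
move=> p0 m0 rev us m'0 rev' ut phits p1 tr d0 D1 Dd DM Ml.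
rewrite -(symmetrized_trace p m0 us) -(symmetrized_trace q m'0 ut).
(* The operator u -> u o phi in the coordinates of [wvec]; the ratio of square roots changes one
   weight into the other. *)
pose W : 'M[R]_(size s, size t) := \matrix_(i, j)
  ((tnth (in_tuple s) i == phi (tnth (in_tuple t) j))%:R *
   Num.sqrt (m' (tnth (in_tuple t) j)) / Num.sqrt (m (tnth (in_tuple s) i))).
have WE u : wvec m s u *m W = wvec m' t (u \o phi).
  apply/rowP => j; rewrite !mxE.
  have /tnthP[i iE] : phi (tnth (in_tuple t) j) \in in_tuple s.
    by apply: phits; exact: mem_tnth.
  rewrite (bigD1 i) //= !mxE -iE eqxx mul1r big1 ?addr0.
    rewrite iE; field; by rewrite gt_eqF // sqrtr_gt0.
  move=> i' i'i; rewrite !mxE iE.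
  by rewrite (inj_eq (tuple_uniqP (in_tuple s) us)) (negbTE i'i) !mul0r mulr0.
apply: (@trace_comparison _ _ _ _ _ W delta D M) => //.
- exact: symmetrized_tr.
- exact: symmetrized_tr.
- exact: symmetrized_ge0.
- move=> v; have [u hu <-] := wvec_surj m0 us v.
  by rewrite quad_symmetrized // sqnorm_wvec // p1.
- move=> tau v taud; have [u hu <-] := wvec_surj m0 us v.
  rewrite WE -!sqnorm_gt0 !sqnorm_wvec // !quad_symmetrized // => u0 hq.
  exact: tr.
Qed.

End TraceTransfer.

(** * Finite sums and approximation of convolution powers *)

Section BoundedSums.
Variable R : realFieldType.

(** For nonnegative [h] this bounds the possibly infinite sum of [h]. Quantifying over
    duplicate-free lists keeps all later estimates at the level of finite sums. *)
Definition sum_bounded (T : eqType) (h : T -> R) (B : R) :=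
  forall s, uniq s -> \sum_(x <- s) h x <= B.

Lemma sumr_const_seq (T : Type) (s : seq T) (c : R) :
  \sum_(x <- s) c = (size s)%:R * c.
Proof.
elim: s => [|x s IHs]; first by rewrite big_nil mul0r.
by rewrite big_cons IHs /= mulrS mulrDl mul1r.
Qed.

Lemma ler_sum_subset (T : eqType) (h : T -> R) (s t : seq T) :
  uniq s -> {subset s <= t} -> (forall x, 0 <= h x) ->
  \sum_(x <- s) h x <= \sum_(x <- t) h x.
Proof.
move=> us st h0; apply: (@le_trans _ _ (\sum_(x <- undup t) h x)).
  rewrite [leRHS](bigID (fun x => x \in s)) /= -(big_filter (undup t) (fun x => x \in s)).
  have pe : perm_eq [seq x <- undup t | x \in s] s; last first.
    by rewrite (perm_big _ pe) lerDl sumr_ge0.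
  apply: uniq_perm; rewrite ?filter_uniq ?undup_uniq // => x.
  by rewrite mem_filter mem_undup andb_idr // => /st.
elim: t {st} => [|x t IHt] /=; first by rewrite !big_nil.
rewrite [leRHS]big_cons; case: ifP => _; last by rewrite big_cons lerD2l.
by apply: le_trans IHt _; rewrite lerDr.
Qed.

Variables (T : eqType).
Implicit Types (h g : T -> R).

Lemma sum_bounded_ge0 h B : sum_bounded h B -> 0 <= B.
Proof. by move=> /(_ [::] isT); rewrite big_nil. Qed.

Lemma sum_bounded_le h g B C : (forall x, h x <= g x) -> B <= C ->
  sum_bounded g B -> sum_bounded h C.
Proof.
by move=> hg BC gB s us; rewrite (le_trans _ BC) // (le_trans _ (gB s us)) // ler_sum.
Qed.

Lemma sum_boundedD h g B C : sum_bounded h B -> sum_bounded g C ->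
  sum_bounded (fun x => h x + g x) (B + C).
Proof. by move=> hB gC s us; rewrite big_split lerD ?hB ?gC. Qed.

Lemma sum_boundedZ h B c : 0 <= c -> sum_bounded h B ->
  sum_bounded (fun x => c * h x) (c * B).
Proof. by move=> c0 hB s us; rewrite -mulr_sumr ler_wpM2l ?hB. Qed.

Lemma sum_bounded_sum (Z : eqType) (l : seq Z) (h : Z -> T -> R) B :
  (forall z, z \in l -> sum_bounded (h z) B) ->
  sum_bounded (fun x => \sum_(z <- l) h z x) ((size l)%:R * B).
Proof.
move=> hB s us; rewrite exchange_big /= -sumr_const_seq big_seq.
by rewrite [leRHS]big_seq; apply: ler_sum => z zl; exact: hB.
Qed.

Lemma sum_bounded_comp_inj (T' : eqType) (phi : T' -> T) h B : injective phi ->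
  sum_bounded h B -> sum_bounded (h \o phi) B.
Proof.
by move=> phi_inj hB s us; rewrite -(big_map phi xpredT) hB // map_inj_uniq.
Qed.

(** Each value [h x] occurs once for every point of the fibre of [phi] over x, and [fib x] is a list
    of at most N elements containing that fibre. *)
Lemma sum_bounded_comp (T' : eqType) (phi : T' -> T) (fib : T -> seq T') h B N :
  (forall x, 0 <= h x) -> (forall y, y \in fib (phi y)) ->
  (forall x, (size (fib x) <= N)%N) ->
  sum_bounded h B -> sum_bounded (h \o phi) (N%:R * B).
Proof.
move=> h0 fibP fibN hB s us /=.
set t := undup (map phi s).
have -> : \sum_(y <- s) h (phi y) = \sum_(y <- s) \sum_(x <- t | phi y == x) h x.
  apply: eq_big_seq => y ys; rewrite -big_filter (big_rem (phi y)) /=; last first.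
    by rewrite mem_filter eqxx mem_undup map_f.
  rewrite big1_seq ?addr0 // => x /=.
  rewrite mem_rem_uniq ?filter_uniq ?undup_uniq // inE mem_filter.
  by move=> /and3P[/negPf ne /eqP e]; rewrite e eqxx in ne.
under eq_bigr do rewrite big_mkcond.
rewrite exchange_big /=; apply: le_trans (_ : \sum_(x <- t) N%:R * h x <= _).
  apply: ler_sum => x _; rewrite -big_mkcond -big_filter sumr_const_seq ler_wpM2r ?h0 // ler_nat.
  apply: leq_trans (fibN x); apply: uniq_leq_size; first exact: filter_uniq.
  by move=> y; rewrite mem_filter => /andP[/eqP <- _].
by rewrite -mulr_sumr ler_wpM2l // hB // undup_uniq.
Qed.

End BoundedSums.

(** * Limits along finite subsets ordered by inclusion *)

Section Eventually.
Variable X : eqType.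

Definition eventually_seq (P : seq X -> Prop) :=
  exists s0 : seq X, forall s, uniq s -> {subset s0 <= s} -> P s.

Lemma eventually_and P Q : eventually_seq P -> eventually_seq Q ->
  eventually_seq (fun s => P s /\ Q s).
Proof.
move=> [s0 Ps] [s1 Qs]; exists (s0 ++ s1) => s us sub; split.
  by apply: Ps => // x xs; apply: sub; rewrite mem_cat xs.
by apply: Qs => // x xs; apply: sub; rewrite mem_cat xs orbT.
Qed.

Lemma eventually_impl (P Q : seq X -> Prop) :
  (forall s, uniq s -> P s -> Q s) -> eventually_seq P -> eventually_seq Q.
Proof. by move=> PQ [s0 Ps]; exists s0 => s us /(Ps s us) /PQ; apply. Qed.

Lemma eventually_subset (s0 : seq X) : eventually_seq (fun s => {subset s0 <= s}).
Proof. by exists s0. Qed.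

Lemma eventually_all (Z : eqType) (l : seq Z) (P : Z -> seq X -> Prop) :
  (forall z, z \in l -> eventually_seq (P z)) ->
  eventually_seq (fun s => forall z, z \in l -> P z s).
Proof.
elim: l => [|z l IHl] h; first by exists [::].
have hl y : y \in l -> eventually_seq (P y).
  by move=> yl; apply: h; rewrite inE yl orbT.
have [s0 hs] := eventually_and (h z (mem_head _ _)) (IHl hl).
exists s0 => s us /(hs s us)[Pz Pl] y; rewrite inE => /orP[/eqP ->//|]; exact: Pl.
Qed.

End Eventually.

Section TruncPow.
Variables (R : rcfType) (X : eqType) (p : X -> X -> R).
Hypothesis p0 : forall a b, 0 <= p a b.
Hypothesis p1 : forall a, sum_bounded (p a) 1.

Lemma trunc_pow_ge0 s k a b : 0 <= trunc_pow p s k a b.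
Proof.
elim: k b => [|k IHk] b /=; first by case: eqP.
by apply: sumr_ge0 => c _; rewrite mulr_ge0.
Qed.

Lemma trunc_pow_mono s t k a b : uniq s -> {subset s <= t} ->
  trunc_pow p s k a b <= trunc_pow p t k a b.
Proof.
move=> us st; elim: k b => [|k IHk] b //=.
apply: le_trans (_ : \sum_(c <- s) trunc_pow p t k a c * p c b <= _).
  by apply: ler_sum => c _; rewrite ler_wpM2r.
by apply: ler_sum_subset => // c; rewrite mulr_ge0 ?trunc_pow_ge0.
Qed.

Lemma trunc_pow_row s k a : uniq s -> sum_bounded (trunc_pow p s k a) 1.
Proof.
move=> us; elim: k => [|k IHk] t ut /=.
  have [at0|at0] := boolP (a \in t).
    rewrite (big_rem a) //= eqxx big1_seq ?addr0 // => c /andP[_].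
    by rewrite mem_rem_uniq // inE eq_sym => /andP[/negPf ->].
  rewrite big1_seq // => c /andP[_ ct]; case: eqP => // ac.
  by move: at0; rewrite ac ct.
rewrite exchange_big /=; apply: le_trans (IHk s us).
by apply: ler_sum => c _; rewrite -mulr_sumr ler_piMr ?trunc_pow_ge0 ?p1.
Qed.

Lemma trunc_pow_map s k a b (phi : X -> X) : injective phi ->
  (forall a b, p (phi a) (phi b) = p a b) ->
  trunc_pow p (map phi s) k (phi a) (phi b) = trunc_pow p s k a b.
Proof.
move=> phi_inj pE; elim: k b => [|k IHk] b /=; first by rewrite (inj_eq phi_inj).
by rewrite big_map; apply: eq_bigr => c _; rewrite IHk pE.
Qed.

(** Detailed balance passes to powers because powers of the symmetric matrix [symmetrized] are
    symmetric. Both points must lie in [s], since they index that matrix. *)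
Lemma trunc_pow_rev (m : X -> R) s k a b : (forall a, 0 < m a) ->
  (forall a b, m a * p a b = p b a * m b) -> uniq s -> a \in s -> b \in s ->
  m a * trunc_pow p s k a b = trunc_pow p s k b a * m b.
Proof.
move=> m0 rev us /(tnthP (in_tuple s))[i ->] /(tnthP (in_tuple s))[j ->].
have Eij := symmetrized_pow p m0 us k i j.
have Eji := symmetrized_pow p m0 us k j i.
have symA := symmetrized_tr s m0 rev; set A := symmetrized p m s in symA Eij Eji *.
have AT l : (A ^+ l)^T = A ^+ l.
  elim: l => [|l IHl]; first by rewrite expr0 trmx1.
  by rewrite {1}exprSr trmx_mul IHl symA mulmxE -exprS.
have : (A ^+ k) i j = (A ^+ k) j i by rewrite -{1}AT mxE.
rewrite Eij Eji.
move: (tnth _ i) (tnth _ j) => {}a {}b E.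
have ra c : Num.sqrt (m c) ^+ 2 = m c by rewrite sqr_sqrtr // ltW.
have rn c : Num.sqrt (m c) != 0 by rewrite gt_eqF // sqrtr_gt0.
rewrite -(ra a) -(ra b); move: E (rn a) (rn b).
move: (Num.sqrt (m a)) (Num.sqrt (m b)) => x y E x0 y0.
have := congr1 (fun z => z * x * y) E.
have -> : x * trunc_pow p s k a b / y * x * y = x ^+ 2 * trunc_pow p s k a b by field.
by move=> ->; field.
Qed.

End TruncPow.

(** * Convolution powers as limits of truncated powers *)

Section KernelPow.
Variables (R : realType) (X : choiceType).

Lemma esum_sum_bounded (h : X -> R) v : (forall x, 0 <= h x) ->
  (\esum_(x in [set: X]) (h x)%:E <= v%:E)%E -> sum_bounded h v.
Proof.
move=> h0 hv s us; rewrite -lee_fin; apply: le_trans hv.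
apply: esum_ge; exists [set` s]; first by split.
by rewrite -fsbig_seq // sumEFin.
Qed.

Lemma sum_bounded_esum (h : X -> R) v : (forall x, 0 <= h x) ->
  sum_bounded h v -> (\esum_(x in [set: X]) (h x)%:E <= v%:E)%E.
Proof.
move=> h0 hv; apply: ge_ereal_sup => _ [F [finF _] <-].
by rewrite fsbig_finite //= sumEFin lee_fin hv // finmap.fset_uniq.
Qed.

Lemma lt_esum_eventually (h : X -> R) (v : R) : (forall x, 0 <= h x) ->
  (v%:E < \esum_(x in [set: X]) (h x)%:E)%E ->
  eventually_seq (fun s => v < \sum_(x <- s) h x).
Proof.
move=> h0 /ereal_sup_gt[_ [F [finF _] <-]].
rewrite fsbig_finite //= sumEFin lte_fin => vF; exists (finmap.enum_fset (fset_set F)) => s us Fs.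
by apply: lt_le_trans vF _; apply: ler_sum_subset => //; exact: finmap.fset_uniq.
Qed.

Variable p : X -> X -> R.
Hypothesis mp : markov_kernel p.

Let p0 a b : 0 <= p a b. Proof. exact: mp.1. Qed.

Lemma markov_sum_bounded a : sum_bounded (p a) 1.
Proof. by apply: esum_sum_bounded => //; rewrite mp.2. Qed.

Lemma markov_eventually a e : 0 < e ->
  eventually_seq (fun s => 1 - e < \sum_(b <- s) p a b).
Proof.
move=> e0; apply: lt_esum_eventually => //.
by rewrite mp.2 lte_fin ltrBlDr ltrDl.
Qed.

Let p1 := markov_sum_bounded.

Let p_le1 a b : p a b <= 1.
Proof. by have := p1 a (s := [:: b]) isT; rewrite big_seq1. Qed.

(** Both halves go through one induction because [kernel_pow] is a [fine], faithful only if the sum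
    is finite. Finiteness at k + 1 comes from the approximation at k: partial sums are limits of
    truncated ones, and those are at most 1 by [trunc_pow_row]. *)
Lemma kernel_pow_trunc k a b :
  (forall s, uniq s -> trunc_pow p s k a b <= kernel_pow p k a b) /\
  (forall e, 0 < e ->
     eventually_seq (fun s => kernel_pow p k a b - e < trunc_pow p s k a b)).
Proof.
elim: k b => [|k IHk] b.
  by split=> [//|e e0]; exists [::] => s _ _ /=; rewrite ltrBlDr ltrDl.
have k0 c : 0 <= kernel_pow p k a c.
  by have [/(_ [::] isT) + _] := IHk c; apply: le_trans; exact: trunc_pow_ge0.
have approx t e : 0 < e -> eventually_seq (fun s =>
    \sum_(c <- t) kernel_pow p k a c * p c b - e < \sum_(c <- t) trunc_pow p s k a c * p c b).
  (* The error is shared among the terms of [t]; the successor covers an empty [t] and makes the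
     final inequality strict. *)
  move=> e0; pose e' := e / (size t).+1%:R.
  have e'0 : 0 < e' by rewrite divr_gt0.
  have := eventually_all (fun c (_ : c \in t) => (IHk c).2 e' e'0).
  apply: eventually_impl => s us hs.
  have h : \sum_(c <- t) kernel_pow p k a c * p c b <=
           \sum_(c <- t) (trunc_pow p s k a c * p c b + e').
    rewrite big_seq [leRHS]big_seq; apply: ler_sum => c ct.
    have := hs c ct; have := p0 c b; have := p_le1 c b.
    move: (kernel_pow _ _ _ _) (trunc_pow _ _ _ _ _) (p c b) => x y z; nra.
  rewrite ltrBlDr; apply: le_lt_trans h _.
  rewrite big_split /= ltrD2l sumr_const_seq /e' mulrCA gtr_pMr //.
  by rewrite ltr_pdivrMr // mul1r ltr_nat.
have term0 c : 0 <= kernel_pow p k a c * p c b by rewrite mulr_ge0.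
have bnd : sum_bounded (fun c => kernel_pow p k a c * p c b) 1.
  move=> t ut; apply/ler_addgt0Pr => e e0; have [s0 hs] := approx t e e0.
  have := hs (undup (s0)) (undup_uniq _) (fun x => etrans (mem_undup _ _)).
  rewrite ltrBlDr => /ltW /le_trans -> //; rewrite lerD2r.
  apply: le_trans (trunc_pow_row p0 p1 k a (undup_uniq s0) ut).
  by apply: ler_sum => c _; rewrite ler_piMr ?trunc_pow_ge0.
have := sum_bounded_esum term0 bnd; rewrite -/(kernel_pow p k.+1 a b).
have : (0 <= \esum_(c in [set: X]) (kernel_pow p k a c * p c b)%:E)%E.
  by apply: esum_ge0 => c _; rewrite lee_fin.
have : kernel_pow p k.+1 a b = fine (\esum_(c in [set: X]) (kernel_pow p k a c * p c b)%:E) by [].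
(* The two bounds just introduced exclude the infinite values. *)
case E : (esum _ _) => [v| |] //= -> _ _; split=> [s us|e e0].
  have vb : sum_bounded (fun c => kernel_pow p k a c * p c b) v.
    by apply: esum_sum_bounded => //; rewrite E.
  apply: le_trans (vb s us); apply: ler_sum => c _; rewrite ler_wpM2r //.
  by have [->] := IHk c.
have e20 : 0 < e / 2 by rewrite divr_gt0.
have [t ht] : eventually_seq (fun t => v - e / 2 < \sum_(c <- t) kernel_pow p k a c * p c b).
  by apply: lt_esum_eventually => //; rewrite E lte_fin ltrBlDr ltrDl.
have {}ht := ht (undup t) (undup_uniq _) (fun x => etrans (mem_undup _ _)).
have := eventually_and (eventually_subset (undup t)) (approx (undup t) _ e20).
apply: eventually_impl => s us [ts h].
apply: lt_le_trans (_ : \sum_(c <- undup t) trunc_pow p s k a c * p c b <= _); first by lra.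
by apply: ler_sum_subset; rewrite ?undup_uniq // => c; rewrite mulr_ge0 ?trunc_pow_ge0.
Qed.

Lemma trunc_pow_le_kernel_pow s k a b : uniq s ->
  trunc_pow p s k a b <= kernel_pow p k a b.
Proof. by have [h _] := kernel_pow_trunc k a b; exact: h. Qed.

Lemma kernel_pow_eventually k a b e : 0 < e ->
  eventually_seq (fun s => kernel_pow p k a b - e < trunc_pow p s k a b).
Proof. by have [_ h] := kernel_pow_trunc k a b; exact: h. Qed.

Lemma kernel_pow_ge0 k a b : 0 <= kernel_pow p k a b.
Proof.
apply: le_trans (trunc_pow_le_kernel_pow k a b (isT : uniq [::])).
exact: trunc_pow_ge0.
Qed.

End KernelPow.

Lemma mean_return_ge0 (R : realType) (G : groupType) (E : finType)
    (p : G * E -> G * E -> R) n : markov_kernel p -> 0 <= mean_return p n.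
Proof.
move=> mp; rewrite /mean_return mulr_ge0 ?invr_ge0 // sumr_ge0 // => i _.
exact: kernel_pow_ge0.
Qed.

(** * Dirichlet forms *)

Lemma sum_support (R : realFieldType) (T : eqType) (h : T -> R) (s t : seq T) :
  uniq s -> uniq t -> {subset s <= t} -> (forall x, x \notin s -> h x = 0) ->
  \sum_(x <- t) h x = \sum_(x <- s) h x.
Proof.
move=> us ut st h0; rewrite (bigID (fun x => x \in s)) /= [X in _ + X]big1 // addr0.
rewrite -big_filter; apply: perm_big; apply: uniq_perm; rewrite ?filter_uniq // => x.
by rewrite mem_filter andb_idr // => /st.
Qed.

Section Dirichlet.
Variables (R : rcfType) (X : eqType) (p : X -> X -> R) (m : X -> R).
Hypothesis p0 : forall a b, 0 <= p a b.
Hypothesis p1 : forall a, sum_bounded (p a) 1.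
Hypothesis m0 : forall a, 0 < m a.
Hypothesis rev : forall a b, m a * p a b = p b a * m b.
Implicit Types (u : X -> R) (s t : seq X).

(** Twice the usual Dirichlet form, as ordered pairs are summed without the factor 1/2. The kernel
    is an argument because powers of [p] are also inserted. *)
Definition wdir (q : X -> X -> R) s u : R :=
  \sum_(a <- s) \sum_(b <- s) m a * q a b * (u a - u b) ^+ 2.

(** Expand the square and use reversibility. The last term is the killing: rows of [p] restricted to
    [s] miss the mass sent outside. *)
Lemma wdirE s u : 2 * (wnorm m s u - wform m p s u) =
  wdir p s u + 2 * \sum_(a <- s) m a * u a ^+ 2 * (1 - \sum_(b <- s) p a b).
Proof.
pose T := \sum_(a <- s) \sum_(b <- s) m a * p a b * u a ^+ 2.
have T' : T = \sum_(a <- s) \sum_(b <- s) m a * p a b * u b ^+ 2.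
  rewrite exchange_big /=; apply: eq_bigr => a _; apply: eq_bigr => b _.
  by rewrite (rev b) [p a b * _]mulrC.
have -> : wdir p s u = 2 * T - 2 * wform m p s u.
  rewrite mulr2n mulrDl mul1r {2}T' /T /wform mulr_sumr -big_split -sumrB /=.
  apply: eq_bigr => a _; rewrite mulr_sumr -big_split -sumrB /=.
  by apply: eq_bigr => b _; ring.
have -> : \sum_(a <- s) m a * u a ^+ 2 * (1 - \sum_(b <- s) p a b) = wnorm m s u - T.
  rewrite /wnorm /T -sumrB; apply: eq_bigr => a _; rewrite mulrBr mulr1 mulr_sumr.
  by congr (_ - _); apply: eq_bigr => b _; ring.
by ring.
Qed.

Lemma wdir_ge0 (q : X -> X -> R) s u : (forall a b, 0 <= q a b) -> 0 <= wdir q s u.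
Proof.
move=> q0; apply: sumr_ge0 => a _; apply: sumr_ge0 => b _.
by rewrite mulr_ge0 ?sqr_ge0 // mulr_ge0 // ltW.
Qed.

Lemma wdir_le s u : uniq s -> wdir p s u <= 2 * (wnorm m s u - wform m p s u).
Proof.
move=> us; rewrite wdirE lerDl mulr_ge0 // sumr_ge0 // => a _.
by rewrite mulr_ge0 ?subr_ge0 ?p1 // mulr_ge0 ?sqr_ge0 // ltW.
Qed.

Lemma wform_le_wnorm s u : uniq s -> wform m p s u <= wnorm m s u.
Proof.
move=> us; rewrite -subr_ge0 -(pmulr_rge0 _ (ltr0n R 2)).
by apply: le_trans (wdir_le u us); exact: wdir_ge0.
Qed.

Lemma wnorm_support s t u : uniq s -> uniq t -> {subset s <= t} ->
  (forall a, a \notin s -> u a = 0) -> wnorm m t u = wnorm m s u.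
Proof.
move=> us ut st u0; apply: sum_support => // a /u0 ->.
by rewrite expr0n mulr0.
Qed.

Lemma wform_support s t u : uniq s -> uniq t -> {subset s <= t} ->
  (forall a, a \notin s -> u a = 0) -> wform m p t u = wform m p s u.
Proof.
move=> us ut st u0; rewrite /wform.
transitivity (\sum_(a <- t) \sum_(b <- s) m a * p a b * (u a * u b)).
  by apply: eq_bigr => a _; apply: sum_support => // b /u0 ->; rewrite !mulr0.
apply: sum_support => // a /u0 ->.
by apply: big1 => b _; rewrite mul0r mulr0.
Qed.

(** Inserting the intermediate point c, (u a - u b)^2 <= 2 (u a - u c)^2 + 2 (u c - u b)^2. Row sums
    are at most 1, and reversibility of the truncated power allows summing over a as well as over b,
    so E_(k+1) <= 2 E_k + 2 E_1. The crude factor 4^k suffices since only the fixed exponent K is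
    used. *)
Lemma wdir_pow s u k : uniq s ->
  wdir (trunc_pow p s k) s u <= 4 ^+ k * wdir p s u.
Proof.
move=> us; have E0 := wdir_ge0 s u p0.
elim: k => [|k IHk].
  rewrite expr0 mul1r; apply: le_trans E0; rewrite /wdir big1 // => a _.
  by rewrite big1 // => b _ /=; case: eqP => [->|]; rewrite ?subrr ?expr0n ?mulr0 ?mul0r.
have step : wdir (trunc_pow p s k.+1) s u <=
    2 * wdir (trunc_pow p s k) s u + 2 * wdir p s u.
  have t0 := trunc_pow_ge0 p0.
  apply: le_trans (_ : \sum_(a <- s) \sum_(b <- s) \sum_(c <- s)
      (2 * (m a * trunc_pow p s k a c * (u a - u c) ^+ 2) * p c b +
       2 * (trunc_pow p s k c a * (m c * p c b * (u c - u b) ^+ 2))) <= _).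
    rewrite /wdir big_seq [leRHS]big_seq; apply: ler_sum => a as0.
    rewrite big_seq [leRHS]big_seq; apply: ler_sum => b bs /=.
    rewrite mulr_sumr mulr_suml [leLHS]big_seq [leRHS]big_seq; apply: ler_sum => c cs.
    have E := trunc_pow_rev k m0 rev us as0 cs.
    have -> : trunc_pow p s k c a * (m c * p c b * (u c - u b) ^+ 2) =
              m a * trunc_pow p s k a c * p c b * (u c - u b) ^+ 2.
      by rewrite E; ring.
    have : 0 <= m a * trunc_pow p s k a c * p c b.
      by rewrite !mulr_ge0 // ltW.
    move: (m a) (trunc_pow _ _ _ _ _) (p c b) (u a) (u b) (u c) => x y z ua ub uc h.
    rewrite -subr_ge0.
    have -> : 2 * (x * y * (ua - uc) ^+ 2) * z + 2 * (x * y * z * (uc - ub) ^+ 2) -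
       x * (y * z) * (ua - ub) ^+ 2 = x * y * z * (ua + ub - 2 * uc) ^+ 2 by ring.
    by rewrite mulr_ge0 ?sqr_ge0.
  under eq_bigr do under eq_bigr do rewrite big_split /=.
  under eq_bigr do rewrite big_split /=.
  rewrite big_split /=; apply: lerD.
    rewrite /wdir mulr_sumr; apply: ler_sum => a _.
    rewrite mulr_sumr exchange_big /=; apply: ler_sum => c _.
    rewrite -mulr_sumr ler_piMr ?p1 //.
    by rewrite mulr_ge0 // mulr_ge0 ?sqr_ge0 // mulr_ge0 ?t0 // ltW.
  under eq_bigr do rewrite exchange_big /=.
  rewrite exchange_big /= /wdir mulr_sumr; apply: ler_sum => c _.
  rewrite exchange_big /= mulr_sumr; apply: ler_sum => b _.
  rewrite -mulr_sumr -mulr_suml ler_pM2l // ler_piMl ?(trunc_pow_row p0 p1) //.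
  by rewrite mulr_ge0 ?sqr_ge0 // mulr_ge0 // ltW.
apply: le_trans step _; rewrite exprS -mulrA.
have h1 : 1 <= 4 ^+ k :> R by apply: exprn_ege1; rewrite ler1n.
have : wdir p s u <= 4 ^+ k * wdir p s u by rewrite ler_peMl.
move: IHk; lra.
Qed.

End Dirichlet.

Section MarkovEnergy.
Variables (R : realType) (X : choiceType) (p : X -> X -> R) (m : X -> R).
Hypothesis mp : markov_kernel p.
Hypothesis m0 : forall a, 0 < m a.
Hypothesis rev : forall a b, m a * p a b = p b a * m b.
Implicit Types (u : X -> R) (s t : seq X).

Let p0 a b : 0 <= p a b. Proof. exact: mp.1. Qed.
Let p1 := markov_sum_bounded mp.

Lemma markov_wform_le s u : uniq s -> wform m p s u <= wnorm m s u.
Proof. exact: wform_le_wnorm. Qed.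

(** The left side is part of the K-step Dirichlet form, which [wdir_pow] compares with the one-step
    form. Paths of K steps leave the support of u, so everything is computed on a larger list [s1],
    where norm and form of u are unchanged; truncation to [s1] costs half of [e]. The factor is 2
    for that half, 4^K for the powers and 2 from [wdir_le]. *)
Lemma kernel_energy s u K c e t (psi : X -> X) : uniq s ->
  (forall a, a \notin s -> u a = 0) -> 0 <= c -> (forall a, c <= m a) -> 0 < e ->
  uniq t -> (forall a, a \in t -> e <= kernel_pow p K a (psi a)) ->
  c * e * \sum_(a <- t) (u a - u (psi a)) ^+ 2 <=
    4 ^+ K.+1 * (wnorm m s u - wform m p s u).
Proof.
move=> us u0 c0 cm e0 ut et.
have e20 : 0 < e / 2 by rewrite divr_gt0.
have [s0 hs] := eventually_all (fun a (_ : a \in t) => kernel_pow_eventually mp K a (psi a) e20).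
pose s1 := undup (s ++ s0 ++ t ++ map psi t).
have us1 : uniq s1 by exact: undup_uniq.
have {}hs a : a \in t -> e / 2 <= trunc_pow p s1 K a (psi a).
  move=> at0; have := hs s1 us1 _ a at0; have := et _ at0.
  move=> h1 h2; suff : kernel_pow p K a (psi a) - e / 2 < trunc_pow p s1 K a (psi a) by lra.
  by apply: h2 => x xs; rewrite mem_undup !mem_cat xs orbT.
have ss1 : {subset s <= s1} by move=> x xs; rewrite mem_undup mem_cat xs.
rewrite -(wnorm_support m us us1 ss1 u0) -(wform_support p m us us1 ss1 u0).
have dle := wdir_le p1 m0 rev u us1; have dpow := wdir_pow p0 p1 m0 rev u K us1.
have h4 : 0 < 4 ^+ K :> R by rewrite exprn_gt0.
suff : c * e * \sum_(a <- t) (u a - u (psi a)) ^+ 2 <= 2 * wdir m (trunc_pow p s1 K) s1 u.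
  move=> h; apply: le_trans h _.
  rewrite exprS -mulrA; apply: le_trans (_ : 2 * (4 ^+ K * (2 * (wnorm m s1 u - wform m p s1 u))) <= _).
    by rewrite ler_pM2l // (le_trans dpow) // ler_wpM2l // ltW.
  by rewrite le_eqVlt; apply/orP; left; apply/eqP; ring.
have q0 := trunc_pow_ge0 p0 s1 K.
have q0' a b : 0 <= m a * trunc_pow p s1 K a b * (u a - u b) ^+ 2.
  by rewrite mulr_ge0 ?sqr_ge0 // mulr_ge0 // ltW.
rewrite /wdir; apply: le_trans (_ : 2 * \sum_(a <- t)
   \sum_(b <- s1) m a * trunc_pow p s1 K a b * (u a - u b) ^+ 2 <= _); last first.
  rewrite ler_pM2l //; apply: ler_sum_subset => //; last by move=> a; exact: sumr_ge0.
  by move=> x xt; rewrite mem_undup !mem_cat xt !orbT.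
rewrite !mulr_sumr big_seq [leRHS]big_seq; apply: ler_sum => a at0.
have pa : psi a \in s1 by rewrite mem_undup !mem_cat map_f ?orbT.
rewrite (bigD1_seq (psi a)) //= mulrDr.
apply: le_trans (_ : 2 * (m a * trunc_pow p s1 K a (psi a) * (u a - u (psi a)) ^+ 2) <= _); last first.
  by rewrite lerDl mulr_ge0 // sumr_ge0.
rewrite [leRHS]mulrA; apply: ler_wpM2r; first exact: sqr_ge0.
have h1 := hs a at0; have h2 := cm a.
move: h1 h2; move: (trunc_pow _ _ _ _ _) (m a) => x y h1 h2.
have : 0 <= c * (x - e / 2) by rewrite mulr_ge0 ?subr_ge0.
have x0 : 0 <= x by lra.
have : 0 <= (y - c) * x by rewrite mulr_ge0 ?subr_ge0.
lra.
Qed.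

(** On a large enough list the rows of the points of [s] have sum close to 1, so the killing term of
    [wdirE] becomes negligible there while norm and form of u stay the same. *)
Lemma energy_le s u B : uniq s -> (forall a, a \notin s -> u a = 0) ->
  (forall s0 : seq X, exists2 s', uniq s' /\ {subset s0 <= s'} & wdir m p s' u <= B) ->
  2 * (wnorm m s u - wform m p s u) <= B.
Proof.
move=> us u0 hB; apply/ler_addgt0Pr => e e0.
pose N := \sum_(a <- s) m a * u a ^+ 2.
have N0 : 0 <= N by apply: sumr_ge0 => a _; rewrite mulr_ge0 ?sqr_ge0 // ltW.
pose e' := e / (2 * (N + 1)).
have e'0 : 0 < e' by rewrite divr_gt0 // mulr_gt0 // ltr_wpDl.
have [s0 hs] := eventually_all (fun a (_ : a \in s) => markov_eventually mp a e'0).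
have [s' [us' sub] hs'] := hB (s ++ s0).
have ss' : {subset s <= s'} by move=> x xs; apply: sub; rewrite mem_cat xs.
have s0s' : {subset s0 <= s'} by move=> x xs; apply: sub; rewrite mem_cat xs orbT.
have {}hs := hs s' us' s0s'.
rewrite -(wnorm_support m us us' ss' u0) -(wform_support p m us us' ss' u0).
rewrite wdirE //; apply: lerD => //.
rewrite (sum_support us us' ss') => [|a /u0 ->]; last by rewrite expr0n mulr0 mul0r.
apply: le_trans (_ : 2 * (N * e') <= _); last first.
  rewrite /e' -subr_ge0.
  have -> : e - 2 * (N * (e / (2 * (N + 1)))) = e / (N + 1).
    by field; rewrite gt_eqF // ltr_wpDl.
  by rewrite divr_ge0 ?addr_ge0 // ltW.
rewrite ler_pM2l // /N mulr_suml big_seq [leRHS]big_seq; apply: ler_sum => a as0.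
apply: ler_wpM2l; first by rewrite mulr_ge0 ?sqr_ge0 // ltW.
by apply: ltW; rewrite ltrBlDr -ltrBlDl; exact: hs.
Qed.

End MarkovEnergy.

(** * Gradients and the Cheeger inequality on groups *)

Section Gradient.
Variables (R : realFieldType) (G : groupType) (S : seq G).
Implicit Types (v : G -> R) (U : seq G).

Definition grad_bounded v (B : R) := forall s, s \in S ->
  sum_bounded (fun x => (v x - v (x * s)%g) ^+ 2) B.

(** Telescope along the word. With k letters left, (x + y)^2 <= (k+1) x^2 + ((k+1)/k) y^2 yields
    (k+1) B + ((k+1)/k) k^2 B = (k+1)^2 B; right translation by the first letter is injective and
    preserves the bound. *)
Lemma grad_bounded_word v B (w : seq G) : 0 <= B -> grad_bounded v B ->
  (forall s, s \in w -> s \in S) ->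
  sum_bounded (fun x => (v x - v (x * \prod_(s <- w) s)%g) ^+ 2)
    ((size w)%:R ^+ 2 * B).
Proof.
move=> B0 vB; elim: w => [_|s w IHw sw].
  move=> t _; rewrite big_nil big1 ?mulr_ge0 ?sqr_ge0 // => x _.
  by rewrite mulg1 subrr expr0n.
have hs : s \in S by apply: sw; exact: mem_head.
have {IHw}IHw := IHw (fun x xw => sw x (mem_behead (s := s :: w) xw)).
(* A single letter is treated apart because the weight (k+1)/k requires k > 0. *)
case: w => [|s' w] in sw IHw *.
  by rewrite big_seq1 expr1n mul1r; exact: vB.
have h := sum_bounded_comp_inj (@mulIg G s) IHw.
set k : R := (size (s' :: w))%:R in IHw h *.
have k0 : 0 < k by rewrite ltr0n.
have -> : (size [:: s, s' & w])%:R = k + 1 by rewrite /k -natr1.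
have := sum_boundedD (sum_boundedZ (addr_ge0 (ltW k0) ler01) (vB s hs))
  (sum_boundedZ (divr_ge0 (addr_ge0 (ltW k0) ler01) (ltW k0)) h).
apply: sum_bounded_le => [x|]; last first.
  by rewrite le_eqVlt; apply/orP; left; apply/eqP; field; rewrite gt_eqF.
rewrite /= [X in v (x * X)%g]big_cons mulgA.
move: (v x) (v (x * s)%g) (v (x * s * _)%g) => a b c.
rewrite -subr_ge0.
have -> : (k + 1) * (a - b) ^+ 2 + (k + 1) / k * (b - c) ^+ 2 - (a - c) ^+ 2 =
   (k * (a - b) - (b - c)) ^+ 2 / k by field; rewrite gt_eqF.
by rewrite divr_ge0 ?sqr_ge0 // ltW.
Qed.

Definition boundary U : nat :=
  \sum_(s <- S) count (fun x => (x * s)%g \notin U) U.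

(** A layer-cake argument by induction on the support. Once the zeros are removed, subtracting the
    minimum c of g on U removes c |U| from the left sum and c times the boundary of U from the right
    one, which the isoperimetric inequality compares; the remainder vanishes at the minimum, so its
    support is smaller. *)
Lemma coarea h (g : G -> R) U : 0 <= h -> uniq U ->
  (forall A, uniq A -> h * (size A)%:R <= (boundary A)%:R) ->
  (forall x, 0 <= g x) -> (forall x, x \notin U -> g x = 0) ->
  h * \sum_(x <- U) g x <=
    \sum_(x <- U) \sum_(s <- S) Num.max 0 (g x - g (x * s)%g).
Proof.
move=> h0 + iso; have [n] := ubnP (size U); elim: n g U => // n IHn g U.
rewrite ltnS => sU uU g0 gU.
have [/hasP[y yU gy]|] := boolP (has (fun x => g x == 0) U).
  pose V := [seq x <- U | g x != 0].
  have VU : {subset V <= U} by move=> x; rewrite mem_filter => /andP[].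
  have gV x : x \notin V -> g x = 0.
    by rewrite mem_filter negb_and negbK => /orP[/eqP//|/gU].
  have uV : uniq V by rewrite filter_uniq.
  have ltV : (size V < n)%N.
    apply: leq_trans sU; rewrite size_filter -(count_predC (fun x => g x != 0)) -addn1 leq_add2l.
    by rewrite -has_count; apply/hasP; exists y; rewrite //= negbK.
  have -> : \sum_(x <- U) g x = \sum_(x <- V) g x.
    rewrite big_filter [RHS]big_mkcond; apply: eq_bigr => x _.
    by case: eqP.
  apply: le_trans (IHn g V ltV uV g0 gV) _; apply: ler_sum_subset => // x.
  by apply: sumr_ge0 => s _; rewrite le_max lexx.
rewrite -all_predC => /allP /= gpos.
case: U => [|z U0] in sU uU gU gpos *; first by rewrite !big_nil mulr0.
set U := z :: U0 in sU uU gU gpos *.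
have [y yU ymin] : exists2 y, y \in U & forall x, x \in U -> g y <= g x.
  rewrite /U; elim: U0 {sU uU gU gpos U} z => [|z' U0 IH] z.
    by exists z; rewrite ?mem_head // => x; rewrite inE => /eqP ->.
  have [y yin ymin] := IH z'; have [le|lt] := leP (g z) (g y).
    exists z; first exact: mem_head.
    move=> x; rewrite inE => /orP[/eqP -> //|/ymin]; exact: le_trans.
  exists y; first by rewrite inE yin orbT.
  by move=> x; rewrite inE => /orP[/eqP ->|/ymin //]; exact: ltW.
pose V := rem y U; pose c := g y.
pose g' x := if x \in U then g x - c else 0.
have g'0 x : 0 <= g' x by rewrite /g'; case: ifP => // /ymin; rewrite subr_ge0.
have g'V x : x \notin V -> g' x = 0.
  rewrite /V /g' mem_rem_uniq // inE negb_and negbK => /orP[/eqP ->|/negPf -> //].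
  by rewrite yU subrr.
have sV : (size V < n)%N by rewrite size_rem //; case: (n) sU.
have gE x : x \in U -> g x = c + g' x by rewrite /g' => ->; rewrite addrC subrK.
have c0 : 0 <= c by exact: g0.
have IH := IHn g' V sV (rem_uniq _ uU) g'0 g'V.
have g'U : \sum_(x <- U) g' x = \sum_(x <- V) g' x.
  by rewrite (big_rem y) //= g'V ?add0r // mem_rem_uniq // inE eqxx.
have -> : \sum_(x <- U) g x = (size U)%:R * c + \sum_(x <- V) g' x.
  rewrite -g'U -sumr_const_seq -big_split /=; apply: eq_big_seq => x; exact: gE.
have step x : x \in U -> \sum_(s <- S) Num.max 0 (g x - g (x * s)%g) =
    c * (\sum_(s <- S) ((x * s)%g \notin U))%:R +
    \sum_(s <- S) Num.max 0 (g' x - g' (x * s)%g).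
  move=> xU; rewrite natr_sum mulr_sumr -big_split /=; apply: eq_bigr => s _.
  have [xs|xs] := boolP ((x * s)%g \in U).
    by rewrite mulr0 add0r !gE // [c + g' x]addrC addrKA.
  rewrite mulr1 (gU _ xs) (_ : g' (x * s)%g = 0); last by rewrite /g' (negbTE xs).
  by rewrite !subr0 gE // !max_r // addr_ge0.
rewrite (eq_big_seq _ step) big_split /= -mulr_sumr -natr_sum.
have -> : (\sum_(x <- U) \sum_(s <- S) ((x * s)%g \notin U) = boundary U)%N.
  rewrite exchange_big /=; apply: eq_bigr => s _; rewrite -sum1_count [RHS]big_mkcond.
  by apply: eq_bigr => x _; case: ifP.
rewrite mulrDr; apply: lerD.
  by rewrite mulrA mulrC ler_wpM2l //; exact: (iso U uU).
apply: le_trans IH _; apply: ler_sum_subset; rewrite ?rem_uniq //.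
  by move=> x; exact: mem_rem.
by move=> x; apply: sumr_ge0 => s _; rewrite le_max lexx.
Qed.

(** Apply [coarea] to v^2, factor the difference of squares, and use Young's inequality with a
    parameter T small enough for the mass term to be absorbed on the left. *)
Lemma cheeger h v U B : 0 < h -> uniq U ->
  (forall A, uniq A -> h * (size A)%:R <= (boundary A)%:R) ->
  (forall x, x \notin U -> v x = 0) -> grad_bounded v B -> 0 <= B ->
  h ^+ 2 * \sum_(x <- U) v x ^+ 2 <= 4 * (size S)%:R ^+ 2 * B.
Proof.
move=> h0 uU iso v0 vB B0.
set N := \sum_(x <- U) v x ^+ 2; set n : R := (size S)%:R.
have N0 : 0 <= N by apply: sumr_ge0 => x _; exact: sqr_ge0.
have v2_0 x : x \notin U -> v x ^+ 2 = 0 by move=> /v0 ->; rewrite expr0n.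
have hN : h * N <= \sum_(x <- U) \sum_(s <- S) Num.max 0 (v x ^+ 2 - v (x * s)%g ^+ 2).
  by apply: coarea => //; [exact: ltW|move=> x; exact: sqr_ge0].
have [n0|n0] := posnP (size S).
  have S0 : S = [::] by apply: size0nil.
  have : h * N <= 0.
    by apply: le_trans hN _; rewrite S0 big1 // => x _; rewrite big_nil.
  rewrite pmulr_rle0 // => N0'; rewrite (_ : N = 0) ?mulr0 ?mulr_ge0 ?sqr_ge0 //.
  by apply/eqP; rewrite eq_le N0 N0'.
have n0' : 0 < n by rewrite ltr0n.
(* With this value the mass term n 2T N is exactly h N / 2. *)
pose T := h / (4 * n).
have T0 : 0 < T by rewrite divr_gt0 // mulr_gt0.
(* The translate of U by s may leave U, but v vanishes there. *)
have shift s : \sum_(x <- U) v (x * s)%g ^+ 2 <= N.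
  rewrite -(big_map (fun x => (x * s)%g) xpredT (fun x => v x ^+ 2)).
  have um : uniq (map (fun x => (x * s)%g) U) by rewrite map_inj_uniq //; exact: mulIg.
  set W := undup (U ++ map (fun x => (x * s)%g) U).
  have UW : {subset U <= W} by move=> x xs; rewrite mem_undup mem_cat xs.
  rewrite /N -(sum_support uU (undup_uniq _) UW v2_0).
  apply: ler_sum_subset => // [x xs|x]; last exact: sqr_ge0.
  by rewrite mem_undup mem_cat xs orbT.
have {}hN : h * N <= n * (B / (2 * T) + 2 * T * N).
  apply: le_trans hN _; rewrite exchange_big /= /n -sumr_const_seq.
  rewrite big_seq [leRHS]big_seq; apply: ler_sum => s sS.
  apply: le_trans (_ : \sum_(x <- U) ((v x - v (x * s)%g) ^+ 2 / (2 * T) +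
     T * (v x ^+ 2 + v (x * s)%g ^+ 2)) <= _).
    apply: ler_sum => x _; move: (v x) (v (x * s)%g) => a b.
    have e0 : 0 <= (a - b) ^+ 2 / (2 * T) + T * (a ^+ 2 + b ^+ 2).
      apply: addr_ge0; first by rewrite divr_ge0 ?sqr_ge0 // mulr_ge0 // ltW.
      by rewrite mulr_ge0 ?addr_ge0 ?sqr_ge0 // ltW.
    rewrite ge_max e0 /= -subr_ge0.
    have -> : (a - b) ^+ 2 / (2 * T) + T * (a ^+ 2 + b ^+ 2) - (a ^+ 2 - b ^+ 2) =
       ((a - b) - T * (a + b)) ^+ 2 / (2 * T) + T / 2 * (a - b) ^+ 2.
      by field; rewrite gt_eqF.
    apply: addr_ge0; first by rewrite divr_ge0 ?sqr_ge0 // mulr_ge0 // ltW.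
    by rewrite mulr_ge0 ?sqr_ge0 // divr_ge0 // ltW.
  rewrite big_split /= -mulr_suml -mulr_sumr big_split /= -/N; apply: lerD.
    by rewrite ler_wpM2r ?vB // invr_ge0 mulr_ge0 // ltW.
  apply: le_trans (_ : T * (N + N) <= _).
    by rewrite ler_pM2l // lerD2l; exact: shift.
  by rewrite le_eqVlt; apply/orP; left; apply/eqP; ring.
have E : n * (B / (2 * T) + 2 * T * N) = 2 * n ^+ 2 * B / h + h * N / 2.
  by rewrite /T; field; rewrite !gt_eqF.
have {E hN}: h * N / 2 <= 2 * n ^+ 2 * B / h by move: hN; rewrite E; lra.
rewrite ler_pdivlMr // => hN; move: hN; rewrite expr2 -[h * h * N]mulrA; lra.
Qed.

End Gradient.

(** * Folner sets and translation-invariant kernels *)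

Definition generating_seq (G : groupType) (S : seq G) :=
  forall x : G, exists2 w : seq G, (forall s, s \in w -> s \in S) &
    (\prod_(s <- w) s)%g = x.

Section Folner.
Variables (G : groupType) (S : seq G).
Hypothesis genS : generating_seq S.

(** A point that exits U along s :: w either exits at s, or x s lies in U and exits along w; right
    translation by s injects the points of the second kind into those counted by induction. *)
Lemma count_exit_word (U w : seq G) : uniq U -> (forall s, s \in w -> s \in S) ->
  (count (fun x => (x * \prod_(s <- w) s)%g \notin U) U <= size w * boundary S U)%N.
Proof.
move=> uU; elim: w => [_|s w IHw sw].
  by rewrite (eq_in_count (a2 := pred0)) ?count_pred0 // => x xU; rewrite big_nil mulg1 /= xU.
have hs : s \in S by apply: sw; exact: mem_head.
have {IHw}IHw := IHw (fun x xw => sw x (mem_behead (s := s :: w) xw)).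
have bs : (count (fun x => (x * s)%g \notin U) U <= boundary S U)%N.
  by rewrite /boundary (big_rem s) //= leq_addr.
pose e x := ((x * s)%g \in U) && ((x * s * \prod_(s <- w) s)%g \notin U).
have be : (count e U <= count (fun x => (x * \prod_(s <- w) s)%g \notin U) U)%N.
  rewrite -(count_map (fun x => (x * s)%g)
    (fun x => (x \in U) && ((x * \prod_(s <- w) s)%g \notin U))).
  rewrite -!size_filter; apply: uniq_leq_size.
    by rewrite filter_uniq // map_inj_uniq //; exact: mulIg.
  by move=> x; rewrite !mem_filter => /andP[/andP[-> ->]].
rewrite mulSn; apply: leq_trans (leq_add bs (leq_trans be IHw)).
rewrite -count_predUI; apply: leq_trans (leq_addr _ _).
by apply: sub_count => x; rewrite /e /= big_cons mulgA => ->; case: (_ \in U).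
Qed.

Lemma count_exit_window (W : seq G) : exists N, forall U, uniq U ->
  (count (fun x => ~~ all (fun w => (x * w)%g \in U) W) U <= N * boundary S U)%N.
Proof.
elim: W => [|z W [N hN]].
  by exists 0%N => U uU; rewrite (eq_count (a2 := pred0)) ?count_pred0.
have [w wS wz] := genS z; exists (size w + N)%N => U uU.
rewrite mulnDl; have := leq_add (count_exit_word uU wS) (hN U uU).
apply: leq_trans; rewrite -count_predUI; apply: leq_trans (leq_addr _ _).
by apply: sub_count => x /=; rewrite wz negb_and.
Qed.

(** If the boundary of U is below |U| / (2(N+1)), with N the constant of [count_exit_window], fewer
    than half of the points x of U have x W not inside U. Strictness of the bound also makes U
    nonempty. *)
Lemma folner_window (R : archiRealFieldType) (W : seq G) :
  (forall h : R, 0 < h -> exists2 U, uniq U & (boundary S U)%:R < h * (size U)%:R) ->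
  exists2 U, uniq U & (0 < size U)%N &&
    (size U <= 2 * count (fun x => all (fun w => (x * w)%g \in U) W) U)%N.
Proof.
move=> fol; have [N hN] := count_exit_window W.
have h0 : 0 < ((2 * N.+1)%:R)^-1 :> R by rewrite invr_gt0 ltr0n.
have [U uU] := fol _ h0; rewrite mulrC ltr_pdivlMr ?ltr0n // -natrM ltr_nat => bU.
exists U => //; apply/andP; split; first exact: leq_ltn_trans (leq0n _) bU.
have := hN U uU; have := count_predC (fun x => all (fun w => (x * w)%g \in U) W) U.
rewrite -[count (predC _) U]/(count (fun x => ~~ all (fun w => (x * w)%g \in U) W) U).
move: bU; set a := count _ U; set b := count _ U; set c := boundary S U.
rewrite mulnCA mulnS [(c * N)%N]mulnC; clearbody a b c; move: (size _) (N * c)%N => k l; lia.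
Qed.

End Folner.

Section Products.
Variables (G : groupType) (E : finType).

Definition blocks (U : seq G) : seq (G * E) := [seq (x, i) | x <- U, i <- enum E].

Lemma mem_blocks U a : (a \in blocks U) = (a.1 \in U).
Proof.
case: a => x i; apply/allpairsP/idP => /= [[[y j] [/= yU _ [-> _]]] //|xU].
by exists (x, i); rewrite mem_enum.
Qed.

Lemma blocks_uniq U : uniq U -> uniq (blocks U).
Proof. by move=> uU; apply: allpairs_uniq; rewrite ?enum_uniq // => -[? ?] [? ?]. Qed.

Lemma big_blocks (R : nmodType) (U : seq G) (F : G * E -> R) :
  \sum_(a <- blocks U) F a = \sum_(x <- U) \sum_i F (x, i).
Proof.
rewrite big_allpairs; apply: eq_bigr => x _.
by rewrite big_enum.
Qed.

Lemma size_blocks U : size (blocks U) = (size U * #|E|)%N.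
Proof. by rewrite size_allpairs -cardT cardE. Qed.

Lemma blocks_cover (s : seq (G * E)) : {subset s <= blocks (undup (map fst s))}.
Proof. by move=> a as0; rewrite mem_blocks mem_undup map_f. Qed.

End Products.

Section TranslationInvariant.
Variables (R : realType) (G : groupType) (E : finType).
Variable p : G * E -> G * E -> R.
Hypothesis mp : markov_kernel p.
Hypothesis inv : forall g x y i j, p ((g * x)%g, i) ((g * y)%g, j) = p (x, i) (y, j).

Let p0 a b : 0 <= p a b. Proof. exact: mp.1. Qed.

Definition translate (g : G) (a : G * E) : G * E := ((g * a.1)%g, a.2).

Lemma translate_inj g : injective (translate g).
Proof. by move=> [x i] [y j] [/mulgI -> ->]. Qed.

Lemma trunc_pow_translate g s k a b :
  trunc_pow p (map (translate g) s) k (translate g a) (translate g b) =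
  trunc_pow p s k a b.
Proof.
apply: trunc_pow_map; first exact: translate_inj.
by move=> [x i] [y j]; exact: inv.
Qed.

Lemma trunc_trace_le V k : uniq V ->
  \sum_(b <- blocks E V) trunc_pow p (blocks E V) k b b <=
  (size V)%:R * \sum_i kernel_pow p k (1%g, i) (1%g, i).
Proof.
move=> uV; rewrite big_blocks -sumr_const_seq; apply: ler_sum => x _.
apply: ler_sum => i _.
have := trunc_pow_translate x^-1%g (blocks E V) k (x, i) (x, i).
rewrite /translate /= mulVg => <-; apply: trunc_pow_le_kernel_pow => //.
by rewrite map_inj_uniq ?blocks_uniq //; exact: translate_inj.
Qed.

(** The window depends on k and on the kernel without any control. This is harmless: only the choice
    of the Folner set depends on it. *)
Lemma kernel_pow_half_window k : exists2 W : seq G, uniq W &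
  forall i, kernel_pow p k (1%g, i) (1%g, i) / 2 <=
            trunc_pow p (blocks E W) k (1%g, i) (1%g, i).
Proof.
have ev (i : E) : i \in enum E -> eventually_seq (fun s : seq (G * E) =>
    kernel_pow p k (1%g, i) (1%g, i) / 2 <= trunc_pow p s k (1%g, i) (1%g, i)).
  move=> _; have [k0|k0] := leP (kernel_pow p k (1%g, i) (1%g, i)) 0.
    exists [::] => s _ _; apply: le_trans (trunc_pow_ge0 p0 _ _ _ _).
    by rewrite ler_pdivrMr // mul0r.
  have k20 : 0 < kernel_pow p k (1%g, i) (1%g, i) / 2 by rewrite divr_gt0.
  apply: eventually_impl (kernel_pow_eventually mp _ _ _ k20) => s _; lra.
have [s0 hs] := eventually_all ev.
exists (undup (map fst s0)) => [|i]; first exact: undup_uniq.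
apply: (hs _ (blocks_uniq _ (undup_uniq _)) (@blocks_cover _ _ s0)).
by rewrite mem_enum.
Qed.

(** At a point x with x W inside U, the walk confined to U returns at least as often as the walk
    confined to x W, which is a translate of the one confined to W. *)
Lemma trunc_trace_ge U W k : uniq U -> uniq W ->
  (forall i, kernel_pow p k (1%g, i) (1%g, i) / 2 <=
            trunc_pow p (blocks E W) k (1%g, i) (1%g, i)) ->
  (count (fun x => all (fun w => (x * w)%g \in U) W) U)%:R *
     ((\sum_i kernel_pow p k (1%g, i) (1%g, i)) / 2) <=
  \sum_(a <- blocks E U) trunc_pow p (blocks E U) k a a.
Proof.
move=> uU uW hW; rewrite big_blocks -size_filter -sumr_const_seq.
apply: le_trans (_ : \sum_(x <- [seq x <- U | all (fun w => (x * w)%g \in U) W])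
   \sum_i trunc_pow p (blocks E U) k (x, i) (x, i) <= _); last first.
  apply: ler_sum_subset; first exact: filter_uniq.
    by move=> x; rewrite mem_filter => /andP[].
  by move=> x; apply: sumr_ge0 => i _; exact: trunc_pow_ge0.
rewrite big_seq [leRHS]big_seq; apply: ler_sum => x; rewrite mem_filter => /andP[/allP xW xU].
rewrite mulr_suml; apply: ler_sum => i _; apply: le_trans (hW i) _.
rewrite -(trunc_pow_translate x) /translate /= mulg1.
apply: trunc_pow_mono => //.
  by rewrite map_inj_uniq ?blocks_uniq //; exact: translate_inj.
by move=> _ /mapP[b + ->]; rewrite !mem_blocks /= => /xW.
Qed.

(** By invariance the double sum is reorganized according to the displacement z = x^-1 y. A
    displacement z costs (l z)^2 B by [grad_bounded_word], and the second moment sums these costs;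
    one factor T bounds the weights, the other the moment. *)
Lemma wdir_translation_le (m : G * E -> R) (T : R) (S : seq G) (l : G -> nat)
    (v : G -> R) B (t : seq G) :
  0 <= T -> (forall a, 0 <= m a <= T) -> 0 <= B ->
  (forall z, exists w : seq G, [/\ size w = l z, forall s, s \in w -> s \in S &
     (\prod_(s <- w) s)%g = z]) ->
  (forall Z : seq G, uniq Z ->
     \sum_i \sum_j \sum_(z <- Z) (l z)%:R ^+ 2 * p (1%g, i) (z, j) <= T) ->
  grad_bounded S v B -> uniq t ->
  wdir m p (blocks E t) (fun a => v a.1) <= T ^+ 2 * B.
Proof.
move=> T0 mT B0 lP mom vB ut; rewrite /wdir big_blocks.
pose Z := undup [seq (x^-1 * y)%g | x <- t, y <- t].
apply: le_trans (_ : T * \sum_i \sum_j \sum_(z <- Z)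
   p (1%g, i) (z, j) * \sum_(x <- t) (v x - v (x * z)%g) ^+ 2 <= _); last first.
  rewrite expr2 -mulrA ler_wpM2l //.
  apply: le_trans (_ : (\sum_i \sum_j \sum_(z <- Z) (l z)%:R ^+ 2 * p (1%g, i) (z, j)) * B <= _).
    rewrite mulr_suml; apply: ler_sum => i _; rewrite mulr_suml; apply: ler_sum => j _.
    rewrite mulr_suml; apply: ler_sum => z _; rewrite [_ ^+ 2 * _]mulrC -mulrA ler_wpM2l //.
    by have [w [<- wS <-]] := lP z; exact: (grad_bounded_word B0 vB wS ut).
  by rewrite ler_wpM2r // mom // undup_uniq.
have shift x i j : x \in t ->
    \sum_(y <- t) p (x, i) (y, j) * (v x - v y) ^+ 2 <=
    \sum_(z <- Z) p (1%g, i) (z, j) * (v x - v (x * z)%g) ^+ 2.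
  move=> xt; have -> : \sum_(y <- t) p (x, i) (y, j) * (v x - v y) ^+ 2 =
      \sum_(z <- map (fun y => (x^-1 * y)%g) t)
        p (1%g, i) (z, j) * (v x - v (x * z)%g) ^+ 2.
    rewrite big_map; apply: eq_bigr => y _; rewrite mulVKg.
    by rewrite -(inv x^-1%g x) mulVg.
  apply: ler_sum_subset => [|z /mapP[y yt ->]|z].
  - by rewrite map_inj_uniq //; exact: mulgI.
  - by rewrite mem_undup; apply/allpairsP; exists (x, y).
  - by rewrite mulr_ge0 ?sqr_ge0.
apply: le_trans (_ : \sum_(x <- t) \sum_i T * \sum_j \sum_(z <- Z)
   p (1%g, i) (z, j) * (v x - v (x * z)%g) ^+ 2 <= _).
  rewrite big_seq [leRHS]big_seq; apply: ler_sum => x xt; apply: ler_sum => i _.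
  rewrite big_blocks exchange_big /= mulr_sumr; apply: ler_sum => j _ /=.
  have /andP[m0 mT'] := mT (x, i).
  apply: le_trans (_ : m (x, i) * \sum_(y <- t) p (x, i) (y, j) * (v x - v y) ^+ 2 <= _).
    by rewrite mulr_sumr le_eqVlt; apply/orP; left; apply/eqP; apply: eq_bigr => y _; rewrite mulrA.
  apply: ler_pM => //; last exact: shift.
  by apply: sumr_ge0 => y _; rewrite mulr_ge0 ?sqr_ge0.
rewrite exchange_big /= mulr_sumr; apply: ler_sum => i _.
rewrite -mulr_sumr ler_wpM2l // exchange_big /=; apply: ler_sum => j _.
rewrite exchange_big /=; apply: ler_sum => z _.
by rewrite mulr_sumr.
Qed.

End TranslationInvariant.

(** * Transport along coarse inverses *)

Lemma sum_bounded_support (R : realFieldType) (T : eqType) (h : T -> R) V :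
  uniq V -> (forall x, 0 <= h x) -> (forall x, x \notin V -> h x = 0) ->
  sum_bounded h (\sum_(x <- V) h x).
Proof.
move=> uV h0 hV s us.
have VW : {subset V <= undup (s ++ V)}.
  by move=> x xV; rewrite mem_undup mem_cat xV orbT.
rewrite -(sum_support uV (undup_uniq _) VW hV); apply: ler_sum_subset => // x xs.
by rewrite mem_undup mem_cat xs.
Qed.

Lemma sqrD_le (R : realFieldType) (a b : R) : (a + b) ^+ 2 <= 2 * a ^+ 2 + 2 * b ^+ 2.
Proof.
rewrite -subr_ge0 (_ : _ - _ = (a - b) ^+ 2) ?sqr_ge0 //; by ring.
Qed.

Section Coarse.
Variables (R : realFieldType) (G1 G2 : groupType).
Variables (S1 : seq G1) (S2 : seq G2) (f : G1 -> G2) (g : G2 -> G1).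
Variables (D1 : seq G1) (D2 : seq G2).
Hypothesis gen1 : generating_seq S1.
Hypothesis g_lip : forall y s, s \in S2 -> ((g y)^-1 * g (y * s))%g \in D1.
Hypothesis gf_close : forall x, (x^-1 * g (f x))%g \in D1.
Hypothesis gf_close' : forall x, ((g (f x))^-1 * x)%g \in D1.
Hypothesis fg_close' : forall y, ((f (g y))^-1 * y)%g \in D2.

Lemma grad_bounded_window (D : seq G1) : exists2 k : R, 0 <= k &
  forall v B, 0 <= B -> grad_bounded S1 v B ->
  forall z, z \in D -> sum_bounded (fun x => (v x - v (x * z)%g) ^+ 2) (k * B).
Proof.
elim: D => [|z D [k k0 hk]]; first by exists 0.
have [w wS wz] := gen1 z; exists (k + (size w)%:R ^+ 2) => [|v B B0 vB y].
  by rewrite addr_ge0 ?sqr_ge0.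
rewrite inE => /orP[/eqP ->|yD].
  rewrite -wz; apply: sum_bounded_le (grad_bounded_word B0 vB wS) => //.
  by rewrite mulrDl lerDr mulr_ge0.
apply: sum_bounded_le (hk v B B0 vB y yD) => //.
by rewrite mulrDl lerDl mulr_ge0 ?sqr_ge0.
Qed.

(** Since y = f(g y) z with z in [D2], the preimage of U under g lies in f(U) [D2]. This makes it a
    finite list and bounds its size by |D2| |U|. *)
Definition preimage_window (U : seq G1) : seq G2 :=
  undup [seq (f x * z)%g | x <- U, z <- D2].

Lemma mem_preimage_window U y : g y \in U -> y \in preimage_window U.
Proof.
move=> yU; rewrite mem_undup; apply/allpairsP.
by exists (g y, ((f (g y))^-1 * y)%g); rewrite /= mulVKg.
Qed.

Definition preimage (U : seq G1) : seq G2 :=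
  [seq y <- preimage_window U | g y \in U].

Lemma preimage_uniq U : uniq (preimage U).
Proof. by rewrite filter_uniq // undup_uniq. Qed.

Lemma mem_preimage U y : (y \in preimage U) = (g y \in U).
Proof. by rewrite mem_filter andb_idr //; exact: mem_preimage_window. Qed.

Lemma size_preimage U : (size (preimage U) <= size D2 * size U)%N.
Proof.
rewrite size_filter (leq_trans (count_size _ _)) // (leq_trans (size_undup _)) //.
by rewrite size_allpairs mulnC.
Qed.

(** A step y -> y s moves g y by an element of [D1], and fibres of g have at most |D2| points: this
    gives the gradient bound. For the norm, u (x, i) is compared with u (x, i0), then with u (g (f
    x), i0); the sum over x of the latter is controlled because fibres of f have at most |D1|
    points. *)
Lemma coarse_transport (E : finType) (i0 : E) s0 : s0 \in S1 ->
  exists2 k : R, 1 <= k & forall (u : G1 * E -> R) B,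
  (forall i j s, s \in S1 ->
     sum_bounded (fun x => (u (x, i) - u ((x * s)%g, j)) ^+ 2) B) ->
  grad_bounded S2 (fun y => u (g y, i0)) (k * B) /\
  forall i U, uniq U -> (forall a, a.1 \notin U -> u a = 0) ->
    \sum_(x <- U) u (x, i) ^+ 2 <=
    k * (\sum_(y <- preimage U) u (g y, i0) ^+ 2 + B).
Proof.
move=> s0S; have [c c0 hc] := grad_bounded_window D1.
set d1 : R := (size D1)%:R; set d2 : R := (size D2)%:R.
have d10 : 0 <= d1 by []. have d20 : 0 <= d2 by [].
have e1 : 0 <= d2 * (d1 * c) by rewrite !mulr_ge0.
have e2 : 0 <= d1 * c by rewrite mulr_ge0.
(* A sum of the coefficients needed below: d2 d1 c for the gradient, 2 d1 from [far], 16 and 4 d1 c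
   from [near]. *)
exists (17 + d2 * (d1 * c) + 2 * d1 + 4 * (d1 * c)); first by lra.
move=> u B uB.
have B0 : 0 <= B by exact: sum_bounded_ge0 (uB i0 i0 _ s0S).
have gB i : grad_bounded S1 (fun x => u (x, i)) B by move=> s; exact: uB.
(* Increments are controlled only along generators, so changing layer over the same x goes through
   the point (x s0, i) and back. This is where a generator must exist. *)
have vert i j : sum_bounded (fun x => (u (x, i) - u (x, j)) ^+ 2) (2 * B + 2 * B).
  have := sum_boundedD (sum_boundedZ (ler0n R 2) (uB i i _ s0S))
    (sum_boundedZ (ler0n R 2) (uB j i _ s0S)).
  apply: sum_bounded_le => // x.
  move: (u (x, i)) (u (x, j)) (u ((x * s0)%g, i)) => y1 y2 y3.
  have -> : y1 - y2 = y1 - y3 + (y3 - y2) by ring.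
  apply: le_trans (sqrD_le _ _) _.
  by rewrite -[(y3 - y2) ^+ 2]sqrrN opprB.
have hor (phi : G1 -> G1) : (forall x, (x^-1 * phi x)%g \in D1) ->
    sum_bounded (fun x => (u (x, i0) - u (phi x, i0)) ^+ 2) (d1 * (c * B)).
  move=> hphi; have := sum_bounded_sum (hc _ B B0 (gB i0)).
  apply: sum_bounded_le => // x.
  rewrite (big_rem _ (hphi x)) /= mulVKg lerDl.
  by apply: sumr_ge0 => z _; exact: sqr_ge0.
split=> [s sS|i U uU u0].
  have hgs y : (g y * ((g y)^-1 * g (y * s)))%g = g (y * s)%g by rewrite mulVKg.
  have fibP y : y \in map (fun z => (f (g y) * z)%g) D2.
    by apply/mapP; exists ((f (g y))^-1 * y)%g; rewrite ?mulVKg.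
  have := sum_bounded_sum (hc _ B B0 (gB i0)).
  set h := (fun x => \sum_(z <- D1) _) => hB.
  have h0 x : 0 <= h x by apply: sumr_ge0 => z _; exact: sqr_ge0.
  have := sum_bounded_comp (phi := g) (fib := fun x => map (fun z => (f x * z)%g) D2)
    (N := size D2) h0 fibP (fun x => eq_leq (size_map _ _)) hB.
  apply: sum_bounded_le => [y|].
    rewrite /= /h (big_rem _ (g_lip y sS)) /= mulVKg lerDl.
    by apply: sumr_ge0 => z _; exact: sqr_ge0.
  rewrite -/d1 -/d2 !mulrA -subr_ge0 -mulrBl mulr_ge0 //; move: e1 e2; lra.
set V := preimage U; set N := \sum_(y <- V) _.
have N0 : 0 <= N by apply: sumr_ge0 => y _; exact: sqr_ge0.
have far : \sum_(x <- U) u (g (f x), i0) ^+ 2 <= d1 * N.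
  have hV y : y \notin V -> u (g y, i0) ^+ 2 = 0.
    by rewrite mem_preimage => yU; rewrite u0 ?expr0n.
  have fibP x : x \in map (fun z => (g (f x) * z)%g) D1.
    by apply/mapP; exists ((g (f x))^-1 * x)%g; rewrite ?mulVKg.
  have := sum_bounded_support (preimage_uniq U) (fun y => sqr_ge0 (u (g y, i0))) hV.
  move/(sum_bounded_comp (phi := f) (fib := fun y => map (fun z => (g y * z)%g) D1)
    (N := size D1) (fun y => sqr_ge0 (u (g y, i0))) fibP (fun x => eq_leq (size_map _ _))).
  by apply.
have near : \sum_(x <- U) (u (x, i) - u (g (f x), i0)) ^+ 2 <=
    2 * (2 * B + 2 * B) + 2 * (d1 * (c * B)).
  have := sum_boundedD (sum_boundedZ (ler0n R 2) (vert i i0))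
    (sum_boundedZ (ler0n R 2) (hor _ gf_close)).
  move=> /(_ U uU); apply: le_trans; apply: ler_sum => x _.
  move: (u (x, i)) (u (x, i0)) (u (g (f x), i0)) => y1 y2 y3.
  have -> : y1 - y3 = y1 - y2 + (y2 - y3) by ring.
  exact: sqrD_le.
apply: le_trans (_ : \sum_(x <- U) (2 * u (g (f x), i0) ^+ 2 +
    2 * (u (x, i) - u (g (f x), i0)) ^+ 2) <= _).
  apply: ler_sum => x _; move: (u (x, i)) (u (g (f x), i0)) => y1 y2.
  have {1}-> : y1 = y2 + (y1 - y2) by ring.
  exact: sqrD_le.
rewrite big_split /= -!mulr_sumr.
have : 0 <= d2 * (d1 * c) * N by rewrite mulr_ge0.
have : 0 <= d2 * (d1 * c) * B by rewrite mulr_ge0.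
have : 0 <= d1 * c * N by rewrite mulr_ge0.
have : 0 <= d1 * B by rewrite mulr_ge0.
move: near far; lra.
Qed.

End Coarse.

(** * Walks with controlled constants *)

Section Walk.
Variables (R : realType) (G : groupType) (E : finType).
Implicit Types (p : G * E -> G * E -> R) (m : G * E -> R) (S : seq G) (l : G -> nat).

Definition reversible_walk (T : R) p m :=
  [/\ markov_kernel p,
      forall g x y i j, p ((g * x)%g, i) ((g * y)%g, j) = p (x, i) (y, j),
      forall a b, m a * p a b = p b a * m b &
      forall a, T^-1 <= m a <= T].

Definition irreducible_walk (T : R) S K p :=
  forall i j x y, (x^-1 * y)%g \in S -> T^-1 <= kernel_pow p K (x, i) (y, j).

Definition moment_walk (T : R) l p :=
  forall Z : seq G, uniq Z ->
    \sum_i \sum_j \sum_(z <- Z) (l z)%:R ^+ 2 * p (1%g, i) (z, j) <= T.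

Definition word_length S l :=
  forall z, exists w : seq G, [/\ size w = l z, forall s, s \in w -> s \in S &
     (\prod_(s <- w) s)%g = z].

Definition energy p m (U : seq G) (u : G * E -> R) :=
  wnorm m (blocks E U) u - wform m p (blocks E U) u.

Section Fixed.
Variables (T : R) (p : G * E -> G * E -> R) (m : G * E -> R).
Hypotheses (T1 : 1 <= T) (wp : reversible_walk T p m).

Let T0 : 0 < T. Proof. exact: lt_le_trans ltr01 T1. Qed.
Let mp : markov_kernel p. Proof. by case: wp. Qed.
Let rev a b : m a * p a b = p b a * m b. Proof. by case: wp. Qed.
Let mT a : T^-1 <= m a <= T. Proof. by case: wp. Qed.

Lemma walk_weight_gt0 a : 0 < m a.
Proof. by have /andP[+ _] := mT a; apply: lt_le_trans; rewrite invr_gt0. Qed.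
Let m0 := walk_weight_gt0.

Variable U : seq G.
Hypothesis uU : uniq U.

Lemma energy_ge0 u : 0 <= energy p m U u.
Proof. by rewrite subr_ge0; apply: markov_wform_le => //; exact: blocks_uniq. Qed.

Lemma walk_gradient S K u : irreducible_walk T S K p ->
  (forall a, a.1 \notin U -> u a = 0) ->
  forall i j s, s \in S ->
  sum_bounded (fun x => (u (x, i) - u ((x * s)%g, j)) ^+ 2)
    (4 ^+ K.+1 * T ^+ 2 * energy p m U u).
Proof.
move=> irr u0 i j s sS t ut.
have inj : injective (fun x : G => (x, i)) by move=> x y [].
have Ti0 : 0 < T^-1 by rewrite invr_gt0.
have us : forall a, a \notin blocks E U -> u a = 0 by move=> a; rewrite mem_blocks => /u0.
have := @kernel_energy _ _ p m mp m0 rev (blocks E U) u K T^-1 T^-1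
  (map (fun x => (x, i)) t) (fun a => ((a.1 * s)%g, j)) (blocks_uniq _ uU) us (ltW Ti0)
  (fun a => proj1 (andP (mT a))) Ti0.
rewrite map_inj_uniq // => /(_ ut).
rewrite big_map => H.
have {}H := H (fun a => _); have {}H : T^-1 * T^-1 * \sum_(x <- t) (u (x, i) - u ((x * s)%g, j)) ^+ 2 <=
    4 ^+ K.+1 * energy p m U u.
  by apply: H => a /mapP[x _ ->]; apply: irr; rewrite mulKg.
have T2 : 0 < T ^+ 2 by rewrite exprn_gt0.
rewrite -(ler_pM2l (mulr_gt0 Ti0 Ti0)); apply: le_trans H _.
by rewrite le_eqVlt; apply/orP; left; apply/eqP; field; rewrite gt_eqF.
Qed.

Lemma walk_energy_le S l v B : word_length S l -> moment_walk T l p ->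
  0 <= B -> grad_bounded S v B -> (forall x, x \notin U -> v x = 0) ->
  energy p m U (fun a => v a.1) <= T ^+ 2 * B.
Proof.
move=> hl hM B0 vB v0.
have inv : forall g x y i j, p ((g * x)%g, i) ((g * y)%g, j) = p (x, i) (y, j) by case: wp.
have := energy_ge0 (fun a => v a.1); rewrite /energy => e0.
suff : 2 * energy p m U (fun a => v a.1) <= T ^+ 2 * B by rewrite /energy; lra.
apply: energy_le => //; first exact: blocks_uniq.
  by move=> a; rewrite mem_blocks => /v0.
move=> s0; exists (blocks E (undup (map fst s0))).
  by split; [exact: blocks_uniq (undup_uniq _)|exact: blocks_cover].
apply: (wdir_translation_le mp inv (ltW T0) _ B0 hl hM vB (undup_uniq _)) => a.
by have /andP[_ ->] := mT a; rewrite ltW.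
Qed.

Lemma walk_norm_le u N : (forall i, \sum_(x <- U) u (x, i) ^+ 2 <= N) ->
  wnorm m (blocks E U) u <= T * (#|E|%:R * N).
Proof.
move=> hN; rewrite /wnorm big_blocks exchange_big /=.
apply: le_trans (_ : \sum_(i : E) T * N <= _); last first.
  by rewrite sumr_const mulrCA [leRHS]mulr_natl.
apply: ler_sum => i _; apply: le_trans (_ : T * \sum_(x <- U) u (x, i) ^+ 2 <= _).
  rewrite mulr_sumr; apply: ler_sum => x _; apply: ler_wpM2r; first exact: sqr_ge0.
  by have /andP[] := mT (x, i).
by rewrite ler_pM2l.
Qed.

Lemma walk_norm_ge (j0 : E) v :
  \sum_(x <- U) v x ^+ 2 <= T * wnorm m (blocks E U) (fun a => v a.1).
Proof.
rewrite /wnorm big_blocks mulr_sumr; apply: ler_sum => x _ /=.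
rewrite (bigD1 j0) //= mulrDr -[leLHS]addr0; apply: lerD.
  rewrite mulrA -[leLHS]mul1r; apply: ler_wpM2r; first exact: sqr_ge0.
  by have /andP[+ _] := mT (x, j0); rewrite -(ler_pM2l T0) divff ?gt_eqF.
rewrite mulr_ge0 ?(ltW T0) // sumr_ge0 // => j _.
by rewrite mulr_ge0 ?sqr_ge0 // ltW.
Qed.

End Fixed.
End Walk.

Section Isoperimetric.
Variables (R : realType) (G : groupType) (E : finType) (S : seq G) (h : R) (K : nat).
Hypotheses (h0 : 0 < h)
  (iso : forall A, uniq A -> h * (size A)%:R <= (boundary S A)%:R).

(** The gap holds on every finite truncation with the same constant, hence for the kernel itself in
    the limit. One T comes from [walk_norm_le] and two from [walk_gradient]; the 1 added to [c]
    keeps the rate nonnegative. *)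
Lemma isoperimetric_return : exists2 k : R, 1 <= k & forall T p (m : G * E -> R),
  1 <= T -> reversible_walk T p m -> irreducible_walk T S K p ->
  forall n, mean_return p n <= (1 - (k * T ^+ 3)^-1) ^+ n.
Proof.
pose c : R := #|E|%:R * (4 * (size S)%:R ^+ 2 * 4 ^+ K.+1 / h ^+ 2).
have c0 : 0 <= c by rewrite mulr_ge0 // divr_ge0 ?sqr_ge0 // !mulr_ge0 ?sqr_ge0 ?exprn_ge0.
exists (1 + c) => [|T p m T1 wp irr n]; first by rewrite lerDl.
set ct := (1 + c) * T ^+ 3.
have T0 : 0 < T by exact: lt_le_trans ltr01 T1.
have ct1 : 1 <= ct by rewrite mulr_ege1 ?exprn_ege1 ?lerDl.
have ct0 : 0 < ct by exact: lt_le_trans ltr01 ct1.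
set rho := 1 - ct^-1.
have rho0 : 0 <= rho by rewrite subr_ge0 invf_le1.
have gap (U : seq G) u : uniq U -> (forall a, a.1 \notin U -> u a = 0) ->
    wform m p (blocks E U) u <= rho * wnorm m (blocks E U) u.
  move=> uU u0; have e0 := energy_ge0 T1 wp uU u.
  have := walk_gradient T1 wp uU irr u0; set B := _ * energy p m U u => grad.
  have B0 : 0 <= B by rewrite mulr_ge0 // mulr_ge0 ?exprn_ge0 // ltW.
  have : wnorm m (blocks E U) u <= T * (#|E|%:R * (4 * (size S)%:R ^+ 2 * B / h ^+ 2)).
    apply: (walk_norm_le T1 wp) => i.
    rewrite ler_pdivlMr ?exprn_gt0 // mulrC; apply: cheeger => //.
      by move=> x xU; rewrite u0.
    by move=> s sS; exact: grad.
  have -> : T * (#|E|%:R * (4 * (size S)%:R ^+ 2 * B / h ^+ 2)) =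
     c * T ^+ 3 * energy p m U u.
    by rewrite /c /B; field; rewrite gt_eqF.
  move=> nc; rewrite mulrBl mul1r -subr_ge0.
  have -> : wnorm m (blocks E U) u - ct^-1 * wnorm m (blocks E U) u -
    wform m p (blocks E U) u = energy p m U u - ct^-1 * wnorm m (blocks E U) u.
    by rewrite /energy; ring.
  rewrite subr_ge0 mulrC ler_pdivrMr //; apply: le_trans nc _.
  rewrite mulrC ler_wpM2l // /ct ler_wpM2r ?exprn_ge0 // ?(ltW T0) //.
  by rewrite lerDr.
have mp : markov_kernel p by case: wp.
have bnd i : kernel_pow p n (1%g, i) (1%g, i) <= rho ^+ n.
  apply/ler_addgt0Pr => e e0.
  have [s0 hs] := kernel_pow_eventually mp n (1%g, i) (1%g, i) e0.
  set U := undup (1%g :: map fst s0).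
  have uU : uniq U by exact: undup_uniq.
  have sub : {subset s0 <= blocks E U}.
    by move=> a as0; rewrite mem_blocks mem_undup inE map_f ?orbT.
  have := hs _ (blocks_uniq _ uU) sub; rewrite ltrBlDr => /ltW /le_trans; apply.
  rewrite lerD2r; apply: (@trunc_pow_diag_le _ _ p m) => //.
  - exact: mp.1.
  - exact: walk_weight_gt0 T1 wp.
  - by case: wp.
  - exact: blocks_uniq.
  - by rewrite mem_blocks mem_undup mem_head.
  - by move=> u u0; apply: gap => // a aU; apply: u0; rewrite mem_blocks.
rewrite /mean_return; have [E0|E0] := posnP #|E|.
  by rewrite E0 invr0 mul0r exprn_ge0.
rewrite mulrC ler_pdivrMr ?ltr0n //.
apply: le_trans (_ : \sum_(i : E) rho ^+ n <= _); first exact: ler_sum.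
by rewrite sumr_const mulr_natr.
Qed.

End Isoperimetric.

(** * Comparison of return probabilities for fixed kernels *)

(** The size s of the Folner set cancels here. In the application c counts its points that see the
    window, v is the size of its preimage, t and t' are the two traces, P and Q the summed return
    probabilities. *)
Lemma window_bound (R : realFieldType) (s c P t t' e X d v Q : R) :
  0 < s -> s <= 2 * c -> 0 <= P -> 0 <= Q -> c * (P / 2) <= t ->
  t <= 2 * (s * e * X + t') -> t' <= v * Q -> v <= d * s ->
  P <= 8 * (e * X + d * Q).
Proof.
move=> s0 sc P0 Q0 cP tt tv vd; rewrite -(ler_pM2l s0).
have : s * P <= 2 * c * P by rewrite ler_wpM2r.
have : v * Q <= d * s * Q by rewrite ler_wpM2r.
lra.
Qed.

(** Turns the odd exponent 2n - 1 back into 2n; the factor 2 pays for one missing 1 - eps >= 1/2. *)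
Lemma pow_succ_bound (R : realFieldType) (eps delta : R) k :
  0 < eps -> eps <= delta -> delta <= 2^-1 ->
  (1 - delta) ^+ k <= 2 * (1 - eps) ^+ k.+1.
Proof.
move=> e0 ed d2; apply: le_trans (_ : (1 - eps) ^+ k <= _).
  by apply: lerXn2r; rewrite ?nnegrE; lra.
rewrite exprS mulrA ler_peMl ?exprn_ge0 //; lra.
Qed.

Lemma mean_bound (R : realFieldType) (e1 e2 P Q X Y d : R) :
  1 <= e1 -> 1 <= e2 -> 0 <= d -> 0 <= Q -> 0 <= Y -> X <= 2 * Y ->
  P <= 8 * (e1 * X + d * Q) ->
  e1^-1 * P <= (16 + 8 * d * e2) * (e2^-1 * Q + Y).
Proof.
move=> e11 e21 d0 Q0 Y0 XY PQ.
have e10 : 0 < e1 by exact: lt_le_trans e11.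
have e20 : 0 < e2 by exact: lt_le_trans e21.
rewrite mulrC ler_pdivrMr //; apply: le_trans PQ _; rewrite -subr_ge0.
have -> : (16 + 8 * d * e2) * (e2^-1 * Q + Y) * e1 - 8 * (e1 * X + d * Q) =
  16 * (e2^-1 * Q) * e1 + 8 * d * Q * (e1 - 1) +
   8 * d * e2 * Y * e1 + 8 * e1 * (2 * Y - X) by field; rewrite gt_eqF.
have e2i : 0 <= e2^-1 by rewrite invr_ge0 ltW.
have e1s : 0 <= e1 - 1 by rewrite subr_ge0.
have ys : 0 <= 2 * Y - X by rewrite subr_ge0.
by rewrite !addr_ge0 // !mulr_ge0 // ltW.
Qed.

(** The bound on tau makes D (N - F) <= N / 4, so the energy term is absorbed and N <= 2 D N'. Then
    N' - F' <= D tau N <= 2 D^2 tau N': the two comparisons each contribute one factor D. *)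
Lemma form_transfer (R : realFieldType) (N F N' F' D tau : R) :
  1 <= D -> 0 <= N - F -> 0 < N -> (1 - tau) * N <= F ->
  tau <= (2 * (2 * D ^+ 2))^-1 ->
  N' - F' <= D * (N - F) -> N <= D * (N' + (N - F)) ->
  0 < N' /\ (1 - 2 * D ^+ 2 * tau) * N' <= F'.
Proof.
move=> D1 L0 N0 hq taud h1 h2.
have D0 : 0 < D by exact: lt_le_trans D1.
have Ltau : N - F <= tau * N by lra.
have tau0 : 0 <= tau by rewrite -(pmulr_lge0 _ N0); exact: le_trans Ltau.
have Ldelta : D * (N - F) <= N / 4.
  apply: le_trans (_ : D * ((2 * (2 * D ^+ 2))^-1 * N) <= _).
    by rewrite ler_pM2l // (le_trans Ltau) // ler_wpM2r // ltW.
  have -> : D * ((2 * (2 * D ^+ 2))^-1 * N) = D^-1 * (N / 4).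
    by field; rewrite gt_eqF.
  by rewrite ler_piMl ?invf_le1 // divr_ge0 // ltW.
have NN' : N <= 2 * D * N' by move: h2; rewrite mulrDr; lra.
split.
  rewrite -(pmulr_rgt0 _ (mulr_gt0 (ltr0n R 2) D0)); exact: lt_le_trans NN'.
have : N' - F' <= 2 * D ^+ 2 * tau * N'; last by lra.
apply: le_trans h1 _; apply: le_trans (_ : D * (tau * (2 * D * N')) <= _).
  by rewrite ler_pM2l // (le_trans Ltau) // ler_wpM2l.
by rewrite le_eqVlt; apply/orP; left; apply/eqP; ring.
Qed.

Section Direction.
Variables (R : realType) (G1 G2 : groupType) (E1 E2 : finType).
Variables (S1 : seq G1) (S2 : seq G2) (f : G1 -> G2) (g : G2 -> G1).
Variables (D1 : seq G1) (D2 : seq G2) (l2 : G2 -> nat) (K : nat).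
Hypothesis gen1 : generating_seq S1.
Hypothesis len2 : word_length S2 l2.
Hypothesis g_lip : forall y s, s \in S2 -> ((g y)^-1 * g (y * s))%g \in D1.
Hypothesis gf_close : forall x, (x^-1 * g (f x))%g \in D1.
Hypothesis gf_close' : forall x, ((g (f x))^-1 * x)%g \in D1.
Hypothesis fg_close' : forall y, ((f (g y))^-1 * y)%g \in D2.
Variables (s0 : G1) (i0 : E1) (j0 : E2).
Hypothesis s0S : s0 \in S1.

(** The energy bound costs T^2 for the gradient of u and T^2 for the energy of w; the norm bound
    costs T^2 and T^3, rounded up to the same T^4. The function w reads only the layer i0 and is
    constant along [E2], so [walk_energy_le] applies to it. *)
Lemma energy_transport : exists2 k : R, 1 <= k &
  forall (T : R) (p : G1 * E1 -> G1 * E1 -> R) (m : G1 * E1 -> R)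
    (q : G2 * E2 -> G2 * E2 -> R) (m' : G2 * E2 -> R) U (u : G1 * E1 -> R),
  1 <= T -> reversible_walk T p m -> irreducible_walk T S1 K p ->
  reversible_walk T q m' -> moment_walk T l2 q ->
  uniq U -> (forall a, a.1 \notin U -> u a = 0) ->
  let D := k * T ^+ 4 in
  let w := fun b : G2 * E2 => u (g b.1, i0) in
  energy q m' (preimage f g D2 U) w <= D * energy p m U u /\
  wnorm m (blocks E1 U) u <=
    D * (wnorm m' (blocks E2 (preimage f g D2 U)) w + energy p m U u).
Proof.
have [k k1 hk] := coarse_transport R gen1 g_lip gf_close gf_close' fg_close' i0 s0S.
pose e1 : R := #|E1|%:R.
have e11 : 1 <= e1 by rewrite ler1n; apply/card_gt0P; exists i0.
have k40 : 1 <= 4 ^+ K.+1 :> R by rewrite exprn_ege1 // ler1n.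
have k0 : 0 <= k by exact: le_trans k1.
exists (e1 * k * 4 ^+ K.+1) => [|T p m q m' U u T1 wp irr wq mom uU u0 D w].
  by rewrite !mulr_ege1.
have T0 : 0 <= T by exact: le_trans T1.
have L0 := energy_ge0 T1 wp uU u.
have grad := walk_gradient T1 wp uU irr u0.
set B := _ * energy p m U u in grad.
have B0 : 0 <= B by rewrite mulr_ge0 // mulr_ge0 ?exprn_ge0.
have [vB nB] := hk u B (fun i j s sS => grad i j s sS).
set V := preimage f g D2 U in vB nB *.
have uV : uniq V by exact: preimage_uniq.
have vV y : y \notin V -> u (g y, i0) = 0 by rewrite mem_preimage // => ?; exact: u0.
have kB0 : 0 <= k * B by rewrite mulr_ge0.
have T24 : T ^+ 2 <= T ^+ 4 by rewrite ler_weXn2l.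
have T34 : T ^+ 3 <= T ^+ 4 by rewrite ler_weXn2l.
split.
  apply: le_trans (walk_energy_le T1 wq uV len2 mom kB0 vB vV) _.
  rewrite /D /B; have -> : T ^+ 2 * (k * (4 ^+ K.+1 * T ^+ 2 * energy p m U u)) =
    1 * (k * 4 ^+ K.+1 * T ^+ 4 * energy p m U u) by ring.
  have -> : e1 * k * 4 ^+ K.+1 * T ^+ 4 * energy p m U u =
    e1 * (k * 4 ^+ K.+1 * T ^+ 4 * energy p m U u) by ring.
  by rewrite ler_wpM2r // mulr_ge0 // mulr_ge0 ?exprn_ge0 // mulr_ge0 ?exprn_ge0.
have := walk_norm_le T1 wp (fun i => nB i U uU u0).
have := walk_norm_ge T1 wq V j0 (fun y => u (g y, i0)).
rewrite -/w; set N := \sum_(y <- V) _; set W := wnorm m' _ w => NW.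
move/le_trans; apply.
have W0 : 0 <= W.
  apply: sumr_ge0 => b _; rewrite mulr_ge0 ?sqr_ge0 // ltW //.
  exact: walk_weight_gt0 T1 wq _.
rewrite -/e1 [D * _]mulrDr; apply: le_trans (_ : T * (e1 * (k * (T * W + B))) <= _).
  by rewrite ler_pM2l ?(lt_le_trans ltr01 T1) // ler_pM2l ?(lt_le_trans ltr01 e11) //
    ler_pM2l ?(lt_le_trans ltr01 k1) // lerD2r.
have -> : T * (e1 * (k * (T * W + B))) =
   e1 * k * W * T ^+ 2 + e1 * k * 4 ^+ K.+1 * energy p m U u * T ^+ 3.
  by rewrite /B; ring.
have e10 : 0 <= e1 by rewrite (le_trans _ e11).
apply: lerD; rewrite /D.
  have -> : e1 * k * 4 ^+ K.+1 * T ^+ 4 * W = (e1 * k * W) * (4 ^+ K.+1 * T ^+ 4) by ring.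
  apply: ler_wpM2l; first by rewrite !mulr_ge0.
  by apply: le_trans T24 _; rewrite ler_peMl // exprn_ge0.
have -> : e1 * k * 4 ^+ K.+1 * T ^+ 4 * energy p m U u =
  e1 * k * 4 ^+ K.+1 * energy p m U u * T ^+ 4 by ring.
by apply: ler_wpM2l => //; rewrite !mulr_ge0 // exprn_ge0.
Qed.

(** Positivity of n makes room for the odd exponent 2n - 1. Allowing any n' below eps n leaves the
    rounding to the final statement. *)
Definition return_bound (C eps : R) (p : G1 * E1 -> G1 * E1 -> R)
    (q : G2 * E2 -> G2 * E2 -> R) :=
  forall n n', (0 < n)%N -> n'%:R <= eps * n%:R ->
    mean_return p (2 * n) <=
      C * (mean_return q (2 * n') + (1 - eps) ^+ (2 * n)).

Lemma folner_return_bound :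
  (forall h : R, 0 < h ->
     exists2 U, uniq U & (boundary S1 U)%:R < h * (size U)%:R) ->
  exists C k : R, [/\ 0 <= C, 1 <= k &
  forall (T : R) (p : G1 * E1 -> G1 * E1 -> R) (m : G1 * E1 -> R)
    (q : G2 * E2 -> G2 * E2 -> R) (m' : G2 * E2 -> R) eps,
  1 <= T -> reversible_walk T p m -> irreducible_walk T S1 K p ->
  reversible_walk T q m' -> moment_walk T l2 q ->
  0 < eps -> k * T ^+ 8 * eps <= 1 -> return_bound C eps p q].
Proof.
move=> fol; have [k k1 hk] := energy_transport.
set e1 : R := #|E1|%:R; set e2 : R := #|E2|%:R; set d2 : R := (size D2)%:R.
have e11 : 1 <= e1 by rewrite ler1n; apply/card_gt0P; exists i0.
have e21 : 1 <= e2 by rewrite ler1n; apply/card_gt0P; exists j0.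
have d20 : 0 <= d2 by [].
(* [C] comes from [mean_bound] and involves only |D2| and |E2|. The factor 12 in the second constant
   is what the comparison of exponents [Mn] consumes. *)
exists (16 + 8 * d2 * e2), (12 * k ^+ 2); split.
- by rewrite addr_ge0 // !mulr_ge0 // ltW // (lt_le_trans _ e21).
- by have := exprn_ege1 2 k1; lra.
move=> T p m q m' eps T1 wp irr wq mom eps0 kT n n' n0 n'n.
set D0 := k * T ^+ 4.
have D01 : 1 <= D0 by rewrite mulr_ege1 // exprn_ege1.
have {}kT : 12 * D0 ^+ 2 * eps <= 1 by apply: le_trans kT; rewrite /D0; lra.
(* [D] is the dilation given by [form_transfer], and [delta] the largest threshold with D delta <=
   1/2. As D0 is of order T^4, [D] is of order T^8. *)
pose D := 2 * D0 ^+ 2; pose delta := (2 * D)^-1.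
have D02 : 1 <= D0 ^+ 2 by exact: exprn_ege1.
have D1' : 2 <= D by rewrite /D; lra.
have D0' : 0 < D by lra.
have dD : 2 * D * delta = 1 by rewrite /delta mulfV //; lra.
have delta0 : 0 < delta by rewrite invr_gt0; lra.
have epsd : eps <= delta.
  rewrite /delta -[X in _ <= X]mul1r ler_pdivlMr; last by lra.
  have := kT; rewrite /D; lra.
have delta12 : delta <= 2^-1.
  by rewrite /delta lef_pV2 ?posrE; lra.
pose M := (Num.truncn (2 * D)).+1.
have DM : 2 * D <= M%:R by apply: ltW; rewrite /M; exact: truncnS_gt.
have MD : M%:R <= 3 * D.
  have : (Num.truncn (2 * D))%:R <= 2 * D by rewrite truncn_le; lra.
  by rewrite /M -natr1; lra.
case: n n0 n'n => // n1 _ n'n.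
(* M 2n' <= 3D 2 eps n = 12 D0^2 eps n <= n <= 2n - 1. *)
have Mn : (M * (2 * n') <= (2 * n1).+1)%N.
  rewrite -(ler_nat R) natrM.
  apply: le_trans (_ : 3 * D * (2 * (eps * n1.+1%:R)) <= _).
    apply: ler_pM => //; rewrite natrM ler_wpM2l //.
  have : 12 * D0 ^+ 2 * eps * n1.+1%:R <= 1 * n1.+1%:R by rewrite ler_wpM2r.
  rewrite /D -natr1 -[(2 * n1).+1%:R]natr1 natrM.
  have : 0 <= n1%:R :> R by []. lra.
have mp : markov_kernel p by case: wp.
have mq : markov_kernel q by case: wq.
have invp : forall g x y i j, p ((g * x)%g, i) ((g * y)%g, j) = p (x, i) (y, j) by case: wp.
have invq : forall g x y i j, q ((g * x)%g, i) ((g * y)%g, j) = q (x, i) (y, j) by case: wq.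
have [W uW hW] := kernel_pow_half_window mp (2 * n1.+1).
have [U uU /andP[U0 UW]] := folner_window gen1 W fol.
set V := preimage f g D2 U.
have uV : uniq V by exact: preimage_uniq.
set P := \sum_i kernel_pow p (2 * n1.+1) (1%g, i) (1%g, i) in hW.
set Q := \sum_j kernel_pow q (2 * n') (1%g, j) (1%g, j).
have lower := trunc_trace_ge mp invp uU uW hW.
have upper := trunc_trace_le mq invq (2 * n') uV.
have tr : \sum_(a <- blocks E1 U) trunc_pow p (blocks E1 U) (2 * n1).+2 a a <=
    2 * ((size (blocks E1 U))%:R * (1 - delta) ^+ (2 * n1).+1 +
         \sum_(b <- blocks E2 V) trunc_pow q (blocks E2 V) (2 * n') b b).
  apply: (@trunc_trace_comparison _ _ _ p m q m' _ _
            (fun b : G2 * E2 => (g b.1, i0)) delta D M) => //.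
  - exact: mp.1.
  - exact: walk_weight_gt0 T1 wp.
  - by case: wp.
  - exact: blocks_uniq.
  - exact: walk_weight_gt0 T1 wq.
  - by case: wq.
  - exact: blocks_uniq.
  - by move=> b; rewrite !mem_blocks /= mem_preimage.
  - by move=> u _; have := energy_ge0 T1 wp uU u; rewrite subr_ge0.
  - move=> tau u u0 taud N0 hq.
    have u0' a : a.1 \notin U -> u a = 0.
      by move=> aU; apply: u0; rewrite mem_blocks.
    have [h1 h2] := hk T p m q m' U u T1 wp irr wq mom uU u0'.
    have L0 := energy_ge0 T1 wp uU u.
    exact: (form_transfer D01 L0 N0 hq taud h1 h2).
  - exact: ltW.
  - by lra.
  - by rewrite dD.
have Q0 : 0 <= Q by apply: sumr_ge0 => j _; exact: kernel_pow_ge0.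
have P0 : 0 <= P by apply: sumr_ge0 => j _; exact: kernel_pow_ge0.
set X := (1 - delta) ^+ (2 * n1).+1 in tr.
set Y := (1 - eps) ^+ (2 * n1.+1).
have XY : X <= 2 * Y.
  by rewrite /Y mulnS add2n; exact: pow_succ_bound.
have Y0 : 0 <= Y by apply: exprn_ge0; lra.
have main : P <= 8 * (e1 * X + d2 * Q).
  apply: (window_bound (s := (size U)%:R)
    (c := (count (fun x => all (fun w => (x * w)%g \in U) W) U)%:R) _ _ P0 Q0 lower _ upper).
  - by rewrite ltr0n.
  - by rewrite -natrM ler_nat.
  - by move: tr; rewrite size_blocks natrM mulnS add2n.
  - by rewrite -natrM ler_nat; exact: size_preimage.
exact: mean_bound main.
Qed.

Lemma return_comparison : exists C k : R, [/\ 0 <= C, 1 <= k &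
  forall (T : R) (p : G1 * E1 -> G1 * E1 -> R) (m : G1 * E1 -> R)
    (q : G2 * E2 -> G2 * E2 -> R) (m' : G2 * E2 -> R) eps,
  1 <= T -> reversible_walk T p m -> irreducible_walk T S1 K p ->
  reversible_walk T q m' -> moment_walk T l2 q ->
  0 < eps -> k * T ^+ 8 * eps <= 1 -> return_bound C eps p q].
Proof.
have [[h h0 iso]|noiso] := pselect (exists2 h : R, 0 < h &
    forall A, uniq A -> h * (size A)%:R <= (boundary S1 A)%:R); last first.
  apply: folner_return_bound => h h0; apply: contrapT => nU; apply: noiso.
  exists h => // A uA; rewrite leNgt; apply/negP => bA; apply: nU.
  by exists A.
have [k k1 hk] := isoperimetric_return E1 K h0 iso.
(* Since T >= 1, the condition k T^8 eps <= 1 also puts eps below the gap 1 / (k T^3), so one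
   condition on eps serves both cases. *)
exists 1, k; split=> // T p m q m' eps T1 wp irr wq mom eps0 kT n n' n0 n'n.
apply: le_trans (hk T p m T1 wp irr (2 * n)%N) _; rewrite mul1r.
have mq : markov_kernel q by case: wq.
have kT0 : 1 <= k * T ^+ 3 by rewrite mulr_ege1 // exprn_ege1.
have kT0' : 0 < k * T ^+ 3 by exact: lt_le_trans kT0.
apply: le_trans (_ : (1 - eps) ^+ (2 * n) <= _); last first.
  by rewrite lerDr; exact: mean_return_ge0.
have ek : eps <= (k * T ^+ 3)^-1.
  rewrite -[X in _ <= X]mul1r ler_pdivlMr // mulrC; apply: le_trans kT.
  rewrite ler_wpM2r ?(ltW eps0) // ler_wpM2l ?(le_trans _ k1) //.
  by rewrite ler_weXn2l.
have ki : (k * T ^+ 3)^-1 <= 1 by rewrite invf_le1.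
by apply: lerXn2r; rewrite ?nnegrE; lra.
Qed.

End Direction.

(** * Word metrics and quasi-isometries *)

Section WordMetric.
Variables (G : groupType) (S : set G).
Hypothesis genS : finite_symmetric_generating S.

Lemma word_dist_is_word x y : is_word S (word_dist S x y) (x^-1 * y)%g.
Proof.
rewrite /word_dist; case: pselect => [h|[]]; last by case: genS => _ _; apply.
by case: ex_minnP => n /asboolP.
Qed.

Lemma word_dist_le n x y : is_word S n (x^-1 * y)%g -> (word_dist S x y <= n)%N.
Proof.
move=> w; rewrite /word_dist; case: pselect => [h|[]]; last by exists n.
by case: ex_minnP => k _; apply; exact/asboolP.
Qed.

Lemma is_wordM n k x y : is_word S n x -> is_word S k y -> is_word S (n + k) (x * y)%g.
Proof.
move=> [v [<- vS <-]] [w [<- wS <-]]; exists (v ++ w); split.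
- by rewrite size_cat.
- by move=> s; rewrite mem_cat => /orP[/vS|/wS].
- by rewrite big_cat.
Qed.

Lemma is_wordV n x : is_word S n x -> is_word S n x^-1%g.
Proof.
have [_ symS _] := genS.
move=> [w [<- wS <-]]; elim: w wS => [_|s w IHw wS].
  by exists [::]; split; rewrite ?big_nil ?invg1.
have {}IHw : is_word S (size w) (\prod_(t <- w) t)^-1%g.
  by apply: IHw => t tw; apply: wS; rewrite inE tw orbT.
rewrite big_cons invgM /= -addn1; apply: is_wordM IHw _.
exists [:: s^-1%g]; split=> [//|t|]; last by rewrite big_seq1.
by rewrite inE => /eqP ->; apply: symS; apply: wS; exact: mem_head.
Qed.

Lemma word_dist_sym x y : (word_dist S x y <= word_dist S y x)%N.
Proof.
apply: word_dist_le; rewrite -[(x^-1 * y)%g]invgK invgM invgK.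
by apply: is_wordV; exact: word_dist_is_word.
Qed.

Lemma word_dist_triangle x y z :
  (word_dist S x z <= word_dist S x y + word_dist S y z)%N.
Proof.
apply: word_dist_le; have -> : (x^-1 * z = x^-1 * y * (y^-1 * z))%g.
  by rewrite mulgA mulgK.
by apply: is_wordM; exact: word_dist_is_word.
Qed.

Lemma word_dist_step x s : S s -> (word_dist S x (x * s) <= 1)%N.
Proof.
move=> sS; apply: word_dist_le; rewrite mulKg; exists [:: s]; split=> // [t|].
  by rewrite inE => /eqP ->.
by rewrite big_seq1.
Qed.

Lemma word_ball n : exists D : seq G, forall x y,
  (word_dist S x y <= n)%N -> (x^-1 * y)%g \in D.
Proof.
have [/finite_seqP[L SL] _ _] := genS.
suff [D hD] : exists D : seq G, forall k z, (k <= n)%N -> is_word S k z -> z \in D.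
  by exists D => x y xy; apply: hD xy _; exact: word_dist_is_word.
elim: n => [|n [D hD]].
  exists [:: 1%g] => k z; rewrite leqn0 => /eqP -> [w [/size0nil -> _ <-]].
  by rewrite big_nil mem_head.
exists (1%g :: [seq (s * z)%g | s <- L, z <- D]) => k z kn [w [wk wS <-]].
case: w wk wS => [|s w] wk wS; first by rewrite big_nil mem_head.
rewrite big_cons inE; apply/orP; right; apply/allpairsP.
exists (s, \prod_(t <- w) t)%g; split=> //=.
  by have := wS s (mem_head _ _); rewrite SL.
apply: (hD (size w)); first by rewrite -ltnS -/(size (s :: w)) wk.
by exists w; split=> // t tw; apply: wS; rewrite inE tw orbT.
Qed.

End WordMetric.

(** Bounded distance is recorded as membership of displacements in fixed finite lists, which is the
    form used for counting fibres and bounding gradients. The data are symmetric in the two groups,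
    so the second inequality follows by exchanging them. *)
Definition coarse_inverses (G1 G2 : groupType) (S1 : set G1) (S2 : set G2)
    (f : G1 -> G2) (g : G2 -> G1) (D1 : seq G1) (D2 : seq G2) :=
  [/\ forall x s, S1 s -> ((f x)^-1 * f (x * s))%g \in D2,
      forall y s, S2 s -> ((g y)^-1 * g (y * s))%g \in D1,
      forall x, (x^-1 * g (f x))%g \in D1 /\ ((g (f x))^-1 * x)%g \in D1 &
      forall y, (y^-1 * f (g y))%g \in D2 /\ ((f (g y))^-1 * y)%g \in D2].

Lemma quasi_isometric_coarse (R : realType) (G1 G2 : groupType)
    (S1 : set G1) (S2 : set G2) :
  finite_symmetric_generating S1 -> finite_symmetric_generating S2 ->
  quasi_isometric R S1 S2 ->
  exists f g D1 D2, coarse_inverses S1 S2 f g D1 D2.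
Proof.
move=> g1 g2 [f [A [B [A1 B0 fAB]]]] /choice[g fg].
have A0 : 0 < A by exact: lt_le_trans A1.
(* The images f (g y) and f (g (y s)) are at distance at most 2B + 1, so the lower quasi-isometry
   bound puts g y and g (y s) within A (2B + 1 + B). A generator step is stretched by f to at most A
   + B. *)
pose n1 := Num.bound (A * (3 * B + 1)); pose n2 := Num.bound (A + B).
have [D1 hD1] := word_ball g1 n1; have [D2 hD2] := word_ball g2 n2.
have lt1 d : d%:R <= A * (3 * B + 1) -> (d <= n1)%N.
  move=> h; apply: ltnW; rewrite -(ltr_nat R); apply: le_lt_trans h _.
  by apply: archi_boundP; rewrite mulr_ge0 ?(ltW A0) //; lra.
have lt2 d : d%:R <= A + B -> (d <= n2)%N.
  move=> h; apply: ltnW; rewrite -(ltr_nat R); apply: le_lt_trans h _.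
  by apply: archi_boundP; rewrite addr_ge0 // ltW.
have back x y d : (word_dist S2 (f x) (f y) <= d)%N ->
    (word_dist S1 x y)%:R <= A * (d%:R + B).
  rewrite -(ler_nat R) => h; have /andP[+ _] := fAB x y; rewrite lerBlDr => h'.
  by rewrite -ler_pdivrMl //; apply: le_trans h' _; rewrite lerD2r.
have fg' y : (word_dist S2 y (f (g y)))%:R <= B.
  by apply: le_trans (fg y); rewrite ler_nat; exact: word_dist_sym.
have gfd x : (word_dist S1 x (g (f x)))%:R <= A * (3 * B + 1).
  apply: le_trans (back _ _ _ (leqnn _)) _; rewrite ler_pM2l //.
  by have := fg' (f x); lra.
exists f, g, D1, D2; split.
- move=> x s sS; apply: hD2; apply: lt2.
  have /andP[_] := fAB x (x * s)%g; move/le_trans; apply; rewrite lerD2r.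
  by rewrite ler_piMr ?(ltW A0) // (ler_nat R _ 1); exact: word_dist_step.
- move=> y s sS; apply: hD1; apply: lt1.
  apply: le_trans (back _ _ _ (leqnn _)) _; rewrite ler_pM2l //.
  have h1 := word_dist_triangle g2 (f (g y)) y (f (g (y * s)%g)).
  have h2 := word_dist_triangle g2 y (y * s)%g (f (g (y * s)%g)).
  have h3 := word_dist_step y sS.
  have : (word_dist S2 (f (g y)) (f (g (y * s)%g)) <=
    word_dist S2 (f (g y)) y + (1 + word_dist S2 (y * s)%g (f (g (y * s)%g))))%N.
    by apply: leq_trans h1 _; rewrite leq_add2l (leq_trans h2) // leq_add2r.
  rewrite -(ler_nat R) !natrD; have := fg y; have := fg' (y * s)%g; lra.
- move=> x; split; apply: hD1; apply: lt1 => //.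
  by apply: le_trans (gfd x); rewrite ler_nat; exact: word_dist_sym.
- by move=> y; split; apply: hD2; apply: lt2; rewrite ler_wpDl // ltW.
Qed.

Lemma coarse_inverses_sym (G1 G2 : groupType) (S1 : set G1) (S2 : set G2) f g D1 D2 :
  coarse_inverses S1 S2 f g D1 D2 -> coarse_inverses S2 S1 g f D2 D1.
Proof. by case. Qed.

Lemma coarse_inverses_finite (G1 G2 : groupType) (S1 : set G1) (S2 : set G2) f g D1 D2 :
  coarse_inverses S1 S2 f g D1 D2 ->
  (exists L : seq G1, forall x, x \in L) -> exists L : seq G2, forall y, y \in L.
Proof.
case=> _ _ _ fgD [L hL]; exists [seq (f x * z)%g | x <- L, z <- D2] => y.
apply/allpairsP; exists (g y, ((f (g y))^-1 * y)%g); split=> //=.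
  by have [] := fgD y.
by rewrite mulVKg.
Qed.

Section Generators.
Variables (G : groupType) (L : seq G).
Hypothesis genL : finite_symmetric_generating [set` L].

Lemma finite_symmetric_generating_seq : generating_seq L.
Proof.
move=> x; have [_ _ /(_ x)[n [w [_ wL <-]]]] := genL; by exists w.
Qed.

Lemma word_dist_word_length : word_length L (word_dist [set` L] 1%g).
Proof.
move=> z; have [w [wn wL wz]] := word_dist_is_word genL 1%g z.
by exists w; split=> //; rewrite wz invg1 mul1g.
Qed.

End Generators.

(** * Universal upper bound, and lower bound on finite groups *)

Section ReturnBounds.
Variables (R : realType) (G : groupType) (E : finType).

Lemma mean_return_le1 (p : G * E -> G * E -> R) n : markov_kernel p ->
  mean_return p n <= 1.
Proof.
move=> mp; rewrite /mean_return; have [->|E0] := posnP #|E|.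
  by rewrite invr0 mul0r.
rewrite mulrC ler_pdivrMr ?ltr0n // mul1r.
apply: le_trans (_ : \sum_(i : E) 1 <= _); last by rewrite sumr_const.
apply: ler_sum => i _; apply/ler_addgt0Pr => e e0.
have [s0 hs] := kernel_pow_eventually mp n (1%g, i) (1%g, i) e0.
have := hs (undup s0) (undup_uniq _) (fun x => etrans (mem_undup _ _)).
rewrite ltrBlDr => /ltW /le_trans; apply; rewrite lerD2r.
have := trunc_pow_row mp.1 (markov_sum_bounded mp) n (1%g, i) (undup_uniq s0)
  (isT : uniq [:: (1%g, i)]).
by rewrite big_seq1.
Qed.

(** Truncating to the whole finite space kills nothing, so the constant function 1 has zero energy
    and an even trace is at least 1. Translation invariance then shares the trace among the points
    of the group. *)
Lemma finite_mean_return_ge (p : G * E -> G * E -> R) m T (L : seq G) n :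
  1 <= T -> reversible_walk T p m -> (forall x, x \in L) -> (0 < #|E|)%N ->
  1 <= (size L)%:R * #|E|%:R * mean_return p (2 * n).
Proof.
move=> T1 wp hL E0; have m0 := walk_weight_gt0 T1 wp; have [mp inv rev _] := wp.
pose U := undup L; have uU : uniq U by exact: undup_uniq.
have us := blocks_uniq E uU.
have hU a : a \in blocks E U by rewrite mem_blocks mem_undup.
have row a : \sum_(b <- blocks E U) p a b = 1.
  apply/eqP; rewrite eq_le (markov_sum_bounded mp) //=.
  apply/ler_addgt0Pr => e e0; have [s0 hs] := markov_eventually mp a e0.
  by rewrite -lerBlDr; apply: ltW; apply: hs.
have [i0 _] : exists i : E, i \in E by apply/card_gt0P.
have N0 : 0 < wnorm m (blocks E U) (fun=> 1).
  rewrite /wnorm (bigD1_seq (1%g, i0)) //= ltr_wpDr ?mulr_gt0 ?exprn_gt0 //.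
  by apply: sumr_ge0 => a _; rewrite mulr_ge0 ?sqr_ge0 // ltW.
have NF : wnorm m (blocks E U) (fun=> 1) <= wform m p (blocks E U) (fun=> 1).
  rewrite /wnorm /wform; apply: ler_sum => a _; rewrite expr1n !mulr1.
  under eq_bigr do rewrite !mulr1.
  by rewrite -mulr_sumr row mulr1.
have := trunc_trace_ge1 m0 rev us n N0 NF; move/le_trans; apply.
apply: le_trans (trunc_trace_le mp inv (2 * n) uU) _.
have E0' : #|E|%:R != 0 :> R by rewrite pnatr_eq0 -lt0n.
rewrite /mean_return -mulrA mulVKf //; apply: ler_wpM2r.
  by apply: sumr_ge0 => j _; exact: kernel_pow_ge0.
by rewrite ler_nat size_undup.
Qed.

End ReturnBounds.

(** * Continuous families *)

Section Within.
Variables (R : realType) (I : set R).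
Implicit Types f g : R -> R.

Lemma within_continuous_add f g : {within I, continuous f} ->
  {within I, continuous g} -> {within I, continuous (fun r => f r + g r)}.
Proof.
move=> /subspace_continuousP fc /subspace_continuousP gc.
by apply/subspace_continuousP => x Ix; apply: cvgD; [exact: fc|exact: gc].
Qed.

Lemma within_continuous_mul f g : {within I, continuous f} ->
  {within I, continuous g} -> {within I, continuous (fun r => f r * g r)}.
Proof.
move=> /subspace_continuousP fc /subspace_continuousP gc.
by apply/subspace_continuousP => x Ix; apply: cvgM; [exact: fc|exact: gc].
Qed.

Lemma within_continuous_cst (c : R) : {within I, continuous (fun _ : R => c)}.
Proof. by apply/subspace_continuousP => x Ix; exact: cvg_cst. Qed.

Lemma within_continuous_inv f : (forall r, I r -> 0 < f r) ->
  {within I, continuous f} -> {within I, continuous (fun r => (f r)^-1)}.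
Proof.
move=> f0 /subspace_continuousP fc; apply/subspace_continuousP => x Ix.
by apply: cvgV; [rewrite gt_eqF ?f0|exact: fc].
Qed.

Lemma within_continuous_pow f n : {within I, continuous f} ->
  {within I, continuous (fun r => f r ^+ n)}.
Proof.
move=> fc; elim: n => [|n IHn].
  by under eq_fun do rewrite expr0; exact: within_continuous_cst.
by under eq_fun do rewrite exprS; exact: within_continuous_mul.
Qed.

End Within.

Section FamilyBounds.
Variables (R : realType) (G : groupType) (E : finType).
Implicit Types (p : G * E -> G * E -> R).

Lemma reversible_walk_le (T T' : R) p m : 1 <= T -> T <= T' ->
  reversible_walk T p m -> reversible_walk T' p m.
Proof.
move=> T1 TT' [mp inv rev mT]; split=> // a; have /andP[h1 h2] := mT a.
rewrite (le_trans h2 TT') andbT; apply: le_trans h1.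
by rewrite lef_pV2 ?posrE // (lt_le_trans ltr01) // (le_trans T1).
Qed.

Lemma irreducible_walk_le (T T' : R) S K p : 1 <= T -> T <= T' ->
  irreducible_walk T S K p -> irreducible_walk T' S K p.
Proof.
move=> T1 TT' h i j x y xy; apply: le_trans (h i j x y xy).
by rewrite lef_pV2 ?posrE // (lt_le_trans ltr01) // (le_trans T1).
Qed.

Lemma moment_walk_le (T T' : R) l p : T <= T' -> moment_walk T l p ->
  moment_walk T' l p.
Proof. by move=> TT' h Z uZ; apply: le_trans TT'; exact: h. Qed.

Lemma second_moment_walk (S : set G) (p : R -> G * E -> G * E -> R) r :
  markov_kernel (p r) -> second_moment S p r \is a fin_num ->
  moment_walk (fine (second_moment S p r)) (word_dist S 1%g) (p r).
Proof.
move=> mp fin Z uZ; rewrite -lee_fin fineK // /second_moment.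
rewrite -sumEFin; apply: lee_sum => i _; rewrite -sumEFin; apply: lee_sum => j _.
apply: esum_ge; exists [set` Z]; first by split=> [|x _]; [exact: finite_seq|].
by rewrite -fsbig_seq // sumEFin.
Qed.

Lemma family_bounds (I : set R) (L : seq G) (p : R -> G * E -> G * E -> R) :
  continuous_markov_family I p -> group_invariant I p -> strongly_reversible I p ->
  uniformly_irreducible I [set` L] p -> continuous_second_moment I [set` L] p ->
  exists (K : nat) (T : R -> R), {within I, continuous T} /\ forall r, I r ->
    [/\ 1 <= T r, exists m, reversible_walk (T r) (p r) m,
        irreducible_walk (T r) L K (p r) &
        moment_walk (T r) (word_dist [set` L] 1%g) (p r)].
Proof.
move=> [mp _] inv [m [c [C [_ rev [cc Cc] cC0 mcC]]]] [K [e [ec e0 irr]]] [M2 M2c].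
pose M r := fine (second_moment [set` L] p r).
have M0 r : I r -> 0 <= M r.
  move=> Ir; have := second_moment_walk (mp r Ir) (M2 r Ir) (isT : uniq [::]).
  apply: le_trans; apply: sumr_ge0 => i _; apply: sumr_ge0 => j _.
  by rewrite big_nil.
(* A sum of bounds instead of their maximum: it dominates each of them and is visibly continuous. *)
exists K, (fun r => 1 + (c r)^-1 + C r + (e r)^-1 + M r); split.
  repeat apply: within_continuous_add => //; first exact: within_continuous_cst.
    by apply: within_continuous_inv => // r /cC0[].
  exact: within_continuous_inv.
move=> r Ir; have [c0 C0] := cC0 r Ir; have e0r := e0 r Ir; have M0r := M0 r Ir.
have ci : 0 < (c r)^-1 by rewrite invr_gt0.
have ei : 0 < (e r)^-1 by rewrite invr_gt0.
set T := _ + M r.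
have T1 : 1 <= T by rewrite /T; lra.
have T0 : 0 < T by exact: lt_le_trans T1.
split=> //.
- exists (m r); split; [exact: mp| | exact: rev|].
    by move=> g x y i j; exact: inv.
  move=> a; have /andP[h1 h2] := mcC r Ir a; apply/andP; split.
    apply: le_trans h1; rewrite -[c r]invrK lef_pV2 ?posrE //; rewrite /T; lra.
  by apply: le_trans h2 _; rewrite /T; lra.
- move=> i j x y xy; apply: le_trans (irr r Ir i j x y xy).
  by rewrite -[e r]invrK lef_pV2 ?posrE //; rewrite /T; lra.
- apply: moment_walk_le (second_moment_walk (mp r Ir) (M2 r Ir)).
  by rewrite -/(M r) /T; lra.
Qed.

End FamilyBounds.

Lemma trivial_group_finite (G : groupType) (L : seq G) : generating_seq L ->
  ~ (exists s, s \in L) -> exists M : seq G, forall x, x \in M.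
Proof.
move=> gen nL; exists [:: 1%g] => x; have [w wL <-] := gen x.
case: w wL => [|s w] wL; first by rewrite big_nil mem_head.
by case: nL; exists s; apply: wL; exact: mem_head.
Qed.

Theorem corollary3p13 (R : realType) (G1 G2 : groupType)
    (S1 : set G1) (S2 : set G2) (E1 E2 : finType) (I : set R)
    (p : R -> G1 * E1 -> G1 * E1 -> R) (q : R -> G2 * E2 -> G2 * E2 -> R) :
  finite_symmetric_generating S1 -> finite_symmetric_generating S2 ->
  quasi_isometric R S1 S2 ->
  amenable G1 R -> amenable G2 R ->
  (0 < #|E1|)%N -> (0 < #|E2|)%N ->
  is_interval I ->
  continuous_markov_family I p -> continuous_markov_family I q ->
  group_invariant I p -> group_invariant I q ->
  strongly_reversible I p -> strongly_reversible I q ->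
  uniformly_irreducible I S1 p -> uniformly_irreducible I S2 q ->
  continuous_second_moment I S1 p -> continuous_second_moment I S2 q ->
  exists (eps : R -> R) (n0 : nat) (C0 : R),
    [/\ {within I, continuous eps},
        forall r, I r -> 0 < eps r < 1,
        0 < C0 &
        forall (r : R) (n : nat), I r ->
          let N := Num.truncn (eps r * n%:R) in
          (n0 <= N)%N ->
          mean_return (p r) (2 * n) <=
            C0 * (mean_return (q r) (2 * N - 2 * n0) +
                  (1 - eps r) ^+ (2 * n)) /\
          mean_return (q r) (2 * n) <=
            C0 * (mean_return (p r) (2 * N - 2 * n0) +
                  (1 - eps r) ^+ (2 * n))].
Proof.
move=> gS1 gS2 qi _ _ E10 E20 _ cp cq ip iq rp rq up uq sp sq.
have [f [g [D1 [D2 cfg]]]] := quasi_isometric_coarse gS1 gS2 qi.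
have [/finite_seqP[L1 S1E] _ _] := gS1; have [/finite_seqP[L2 S2E] _ _] := gS2.
rewrite {}S1E {}S2E in gS1 gS2 cfg up uq sp sq *.
have [K1 [T1 [T1c hp]]] := family_bounds cp ip rp up sp.
have [K2 [T2 [T2c hq]]] := family_bounds cq iq rq uq sq.
have gen1 := finite_symmetric_generating_seq gS1.
have gen2 := finite_symmetric_generating_seq gS2.
have mp r : I r -> markov_kernel (p r) by move=> Ir; have [/(_ r Ir)] := cp.
have mq r : I r -> markov_kernel (q r) by move=> Ir; have [/(_ r Ir)] := cq.
have [fin|nofin] := pselect ((exists M1 : seq G1, forall x, x \in M1) /\
                             (exists M2 : seq G2, forall y, y \in M2)).
  have [[M1 hM1] [M2 hM2]] := fin.
  set c1 : R := (size M1)%:R * #|E1|%:R; set c2 : R := (size M2)%:R * #|E2|%:R.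
  have c10 : 0 <= c1 by rewrite mulr_ge0.
  have c20 : 0 <= c2 by rewrite mulr_ge0.
  (* On finite groups the even return means lie between a positive constant and 1, so the value of
     epsilon is immaterial. *)
  exists (fun=> 2^-1), 0%N, (1 + c1 + c2); split.
  - exact: within_continuous_cst.
  - by move=> r _; lra.
  - by lra.
  - move=> r n Ir N _; rewrite muln0 subn0.
    have [T11 [m wm] _ _] := hp r Ir; have [T21 [m' wm'] _ _] := hq r Ir.
    have h1 := finite_mean_return_ge N T11 wm hM1 E10.
    have h2 := finite_mean_return_ge N T21 wm' hM2 E20.
    have p1 := mean_return_le1 (2 * n) (mp r Ir).
    have q1 := mean_return_le1 (2 * n) (mq r Ir).
    have pN := mean_return_ge0 (2 * N) (mp r Ir).
    have qN := mean_return_ge0 (2 * N) (mq r Ir).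
    rewrite -/c1 -/c2 in h1 h2.
    have Z0 : 0 <= (1 - 2^-1 : R) ^+ (2 * n) by apply: exprn_ge0; lra.
    move: (_ ^+ _) Z0 => Z Z0; split.
      apply: le_trans p1 (le_trans h2 _).
      by apply: ler_pM => //; [lra|rewrite lerDl].
    apply: le_trans q1 (le_trans h1 _).
    by apply: ler_pM => //; [lra|rewrite lerDl].
(* Without generators [G1] would be trivial, and [G2] finite through the coarse inverses, which is
   the case already treated. *)
have [s1 s1L] : exists s, s \in L1.
  apply: contrapT => nL1; apply: nofin.
  have h1 : exists M : seq G1, forall x, x \in M by exact: trivial_group_finite gen1 nL1.
  by split=> //; exact: coarse_inverses_finite cfg h1.
have [s2 s2L] : exists s, s \in L2.
  apply: contrapT => nL2; apply: nofin.
  have h2 : exists M : seq G2, forall x, x \in M by exact: trivial_group_finite gen2 nL2.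
  by split=> //; exact: coarse_inverses_finite (coarse_inverses_sym cfg) h2.
have [i1 _] : exists i : E1, i \in E1 by apply/card_gt0P.
have [i2 _] : exists i : E2, i \in E2 by apply/card_gt0P.
have [f_lip g_lip gf fg] := cfg.
have [C1 [k1 [C10 k11 h1]]] := return_comparison R (E1 := E1) (E2 := E2)
  K1 gen1 (word_dist_word_length gS2) g_lip (fun x => (gf x).1) (fun x => (gf x).2)
  (fun y => (fg y).2) i1 i2 s1L.
have [C2 [k2 [C20 k21 h2]]] := return_comparison R (E1 := E2) (E2 := E1)
  K2 gen2 (word_dist_word_length gS1) f_lip (fun y => (fg y).1) (fun y => (fg y).2)
  (fun x => (gf x).2) i2 i1 s2L.
pose T r := T1 r + T2 r; pose k := k1 + k2.
pose eps r := (k * T r ^+ 8 + 1)^-1.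
have T_ge r : I r -> [/\ 1 <= T1 r, 1 <= T2 r, T1 r <= T r, T2 r <= T r & 1 <= T r].
  move=> Ir; have [T11 _ _ _] := hp r Ir; have [T21 _ _ _] := hq r Ir.
  by split=> //; rewrite /T; lra.
have kT_gt0 r : I r -> 0 < k * T r ^+ 8.
  move=> /T_ge[_ _ _ _ Tr]; apply: mulr_gt0; first by rewrite /k; lra.
  by rewrite exprn_gt0 // (lt_le_trans ltr01).
have eps_gt0 r : I r -> 0 < eps r.
  by move=> /kT_gt0 kT; rewrite invr_gt0 addr_gt0.
have eps_k r k' : I r -> k' <= k -> k' * T r ^+ 8 * eps r <= 1.
  move=> Ir k'k; have kT := kT_gt0 r Ir; have [_ _ _ _ Tr] := T_ge r Ir.
  rewrite /eps ler_pdivrMr ?addr_gt0 // mul1r.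
  apply: le_trans (_ : k * T r ^+ 8 <= _); last by rewrite lerDl.
  by rewrite ler_wpM2r // exprn_ge0 // (le_trans ler01).
(* The value 1 only serves to force n > 0: the comparison holds at every time n' <= eps n and is
   used at N - 1. *)
exists eps, 1%N, (C1 + C2 + 1); split.
- apply: within_continuous_inv => [r /kT_gt0 kT|]; first by rewrite addr_gt0.
  apply: within_continuous_add; last exact: within_continuous_cst.
  apply: within_continuous_mul; first exact: within_continuous_cst.
  by apply: within_continuous_pow; exact: within_continuous_add.
- move=> r Ir; rewrite eps_gt0 //= /eps invf_lt1 ?addr_gt0 ?kT_gt0 //.
  by rewrite ltrDr kT_gt0.
- by lra.
move=> r n Ir N N1.
have n0 : (0 < n)%N.
  by rewrite lt0n; apply: contraTneq N1 => n0; rewrite /N n0 mulr0 truncn0.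
have -> : (2 * N - 2 * 1 = 2 * N.-1)%N by rewrite -mulnBr subn1.
have Nn : N.-1%:R <= eps r * n%:R.
  apply: le_trans (_ : N%:R <= _); first by rewrite ler_nat leq_pred.
  by rewrite truncn_le // mulr_ge0 // ltW // eps_gt0.
have [T11 T21 TT1 TT2 T1r] := T_ge r Ir.
have [_ [m wm] irr1 mom1] := hp r Ir; have [_ [m' wm'] irr2 mom2] := hq r Ir.
have wmT := reversible_walk_le T11 TT1 wm.
have wmT' := reversible_walk_le T21 TT2 wm'.
have b1 := h1 (T r) (p r) m (q r) m' (eps r) T1r wmT
  (irreducible_walk_le T11 TT1 irr1) wmT' (moment_walk_le TT2 mom2)
  (eps_gt0 r Ir) (eps_k r k1 Ir _) n N.-1 n0 Nn.
have b2 := h2 (T r) (q r) m' (p r) m (eps r) T1r wmT'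
  (irreducible_walk_le T21 TT2 irr2) wmT (moment_walk_le TT1 mom1)
  (eps_gt0 r Ir) (eps_k r k2 Ir _) n N.-1 n0 Nn.
have kk1 : k1 <= k by rewrite /k; lra.
have kk2 : k2 <= k by rewrite /k; lra.
have eps1 : 0 <= 1 - eps r.
  by rewrite subr_ge0 /eps invf_le1 ?addr_gt0 ?kT_gt0 // lerDr ltW ?kT_gt0.
have Y0 : 0 <= (1 - eps r) ^+ (2 * n) by exact: exprn_ge0.
split.
  apply: le_trans (b1 kk1) _; rewrite ler_wpM2r ?addr_ge0 ?mean_return_ge0 //; last by lra.
  exact: mq.
apply: le_trans (b2 kk2) _; rewrite ler_wpM2r ?addr_ge0 ?mean_return_ge0 //; last by lra.
exact: mp.
Qed.
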